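(* Let $H_0$ be a Hilbert space (real or complex) equipped with an indefinite inner product $\{\cdot,\cdot\}_0$, and let $U_0$ be a $\{\cdot,\cdot\}_0$-unitary operator on $H_0$. Suppose $U_0$ is bounded and has no nonzero $\{\cdot,\cdot\}_0$-neutral invariant subspace. Let $x_0\in H_0$ be such that all the vectors $U_0^Nx_0$ $(N\in\mathbb Z)$ are linearly independent and $x_0$ is a $\mathbb Z$-cyclic vector of $U_0$, i.e. $H_0=\overline{L_{x_0}}$, where $L_{x_0}=\mathrm{span}\{U_0^Nx_0:N\in\mathbb Z\}$. Suppose also that a sequence of weights $\{u_n\}_{n\in\mathbb Z}$ is chosen so that the associated bilateral weighted shift $U$ has Property A (defined in the context). On $L_{x_0}\oplus L_{x_0}$ consider the operator $U_0\oplus U_0$ and the form $$\{x\oplus y,x_1\oplus y_1\}_{-}=\{x,x_1\}_0-\{y,y_1\}_0 .$$ Then: (a) there exists a (pre-)Hilbert norm on $L_{x_0}\oplus L_{x_0}$ such that $\{\cdot,\cdot\}_{-}$ and $U_0\oplus U_0$ are continuous and can be extended to continuous $\{\cdot,\cdot\}_{ext}$ and $U_{ext}$ on $H_{ext}$, the completion of $L_{x_0}\oplus L_{x_0}$; (b) there are two $U_{ext}^{\pm1}$-invariant (closed) subspaces $\mathcal L_{+},\mathcal L_{-}\subset H_{ext}$ such that (1) $\mathcal L_{+}$ is strictly positive; (2) $\mathcal L_{-}$ is strictly negative; (3) $\mathcal L_{+}\cap\mathcal L_{-}=\{0\}$; (4) $\mathcal L_{+}+\mathcal L_{-}$ is dense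 in $H_{ext}$; (5) $\{\mathcal L_{+},\mathcal L_{-}\}_{ext}=\{0\}$, i.e. $\{x,y\}_{ext}=0$ for all $x\in\mathcal L_{+}$, $y\in\mathcal L_{-}$; (6) as semidefinite subspaces, $\mathcal L_{+}$ and $\mathcal L_{-}$ are both maximal.
   Context: An indefinite inner product is a Hermitian sesquilinear form, not assumed positive; sesquilinear forms are linear in the second argument. $U_0$ being $\{\cdot,\cdot\}_0$-unitary means that $U_0$ is linear and injective, all powers $U_0^N$ $(N\in\mathbb Z)$ exist, and $\{U_0x,U_0y\}_0=\{x,y\}_0=\{U_0^{-1}x,U_0^{-1}y\}_0$. A subspace $M$ is neutral if $\{x,x\}_0=0$ for all $x\in M$. A subspace $\mathcal L\subset H_{ext}$ is strictly positive (strictly negative) if $\{x,x\}_{ext}>0$ ($<0$) for all nonzero $x\in\mathcal L$. Maximality in (6) means: $\mathcal L_{+}$ is not properly contained in any subspace on which $\{x,x\}_{ext}\ge0$, and $\mathcal L_{-}$ is not properly contained in any subspace on which $\{x,x\}_{ext}\le0$. Weights and Property A: $H$ is a separable Hilbert space with scalar product $(\cdot,\cdot)$ and an orthonormal basis $\{b_n\}_{n\in\mathbb Z}$. The $u_n$ are nonzero scalars with $\overline{u_{-n}}=u_n$ and $\{\frac1{u_N}\{x_0,U_0^Nx_0\}_0\}_{N\in\mathbb Z}\in\ell_2(\mathbb Z)$. $U$ is the bilateral weighted shift generated by $Ub_n=\frac{u_{n+1}}{u_n}b_{n+1}$, and $f_0\in H$ is the vector with coordinates $(b_N,f_0)=\frac12\frac{\overline{u_0}}{\overline{u_N}}\overline{\{x_0,U_0^Nx_0\}_0}$.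 On $H\oplus H$ put $\{x\oplus y,x'\oplus y'\}=(x,y')+(y,x')$, and for $g,h\in H$ put $L_{g\oplus h}=\mathrm{span}\{U^Ng\oplus(U^* )^{-N}h:N\in\mathbb Z\}$. $U$ has Property A iff from $f_0\ne0$ and $\{x,g_1\oplus h_1\}=0$ for all $x\in L_{b_0\oplus f_0}+L_{b_0\oplus -f_0}$ one can deduce $g_1\oplus h_1=0\oplus0$. *)

(* Defs.v *)
From mathcomp Require Import all_boot all_order all_algebra.
From mathcomp Require Import complex.
From mathcomp Require Import all_classical all_reals all_analysis.

Set Implicit Arguments.
Unset Strict Implicit.
Unset Printing Implicit Defensive.

Import Order.TTheory GRing.Theory Num.Theory.
Import numFieldNormedType.Exports.

Local Open Scope classical_set_scope.
Local Open Scope ring_scope.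

(* The scalar field, together with its conjugation, is either a field of real
   numbers with the identity or a field R[i] of complex numbers with the
   complex conjugation.  A Hilbert space over K is a [completeNormedModType K]
   whose (K-valued) norm comes from an inner product, see [inner_product]. *)
Inductive real_or_complex : forall K : numFieldType, (K -> K) -> Prop :=
| RealScalars (R : realType) : real_or_complex (fun x : R => x)
| ComplexScalars (R : realType) : real_or_complex (fun z : R[i] => conjc z).

Section LinearSpaces.
Context {K : numFieldType}.
Implicit Types V W : lmodType K.

Definition linear_subspace V (M : set V) : Prop :=
  M 0 /\ forall (a : K) x y, M x -> M y -> M (a *: x + y).

Definition lspan V (S : set V) : set V := smallest (@linear_subspace V) S.

Definition sum_set V (A B : set V) : set V := [set x + y | x in A & y in B].

Definition linear_on V W (D : set V) (f : V -> W) : Prop :=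
  forall (a : K) x y, D x -> D y -> f (a *: x + y) = a *: f x + f y.

Definition lin_indep_family V (v : int -> V) : Prop :=
  forall (s : seq int) (c : int -> K), uniq s ->
    \sum_(k <- s) c k *: v k = 0 -> {in s, forall k, c k = 0}.

Definition op_invariant V (T : V -> V) (M : set V) : Prop := T @` M `<=` M.

(* [inv_op T] and [zpow T N] (the N-th power of T, N an integer) are total
   functions; they have their expected meaning when T is bijective. *)
Definition inv_op V (T : V -> V) : V -> V := 'pinv_(fun=> 0) [set: V] T.

Definition zpow V (T : V -> V) (N : int) : V -> V :=
  match N with
  | Posz n => iter n T
  | Negz n => iter n.+1 (inv_op T)
  end.

Definition orbit_span V (T : V -> V) (x : V) : set V :=
  lspan (range (fun N : int => zpow T N x)).

Definition oplus_op V (T : V -> V) (p : V * V) : V * V := (T p.1, T p.2).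

End LinearSpaces.

Section Forms.
Context {K : numFieldType} (conj : K -> K).
Implicit Types V : lmodType K.

(* Hermitian sesquilinear forms are linear in the second argument, in contrast
   with the [{hermitian _ for _ & _}] of the library. *)
Definition hermitian_form_on V (D : set V) (f : V -> V -> K) : Prop :=
  (forall x, D x -> linear_on D (f x : V -> K^o)) /\
  (forall x y, D x -> D y -> f y x = conj (f x y)).

Definition hermitian_form V (f : V -> V -> K) : Prop :=
  hermitian_form_on [set: V] f.

Definition form_unitary V (f : V -> V -> K) (T : V -> V) : Prop :=
  [/\ bijective T,
      forall x y, f (T x) (T y) = f x y &
      forall x y, f (inv_op T x) (inv_op T y) = f x y].

Definition neutral V (f : V -> V -> K) (M : set V) : Prop :=
  forall x, M x -> f x x = 0.

Definition strictly_positive V (f : V -> V -> K) (M : set V) : Prop :=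
  forall x, M x -> x != 0 -> 0 < f x x.

Definition strictly_negative V (f : V -> V -> K) (M : set V) : Prop :=
  forall x, M x -> x != 0 -> f x x < 0.

Definition nonnegative V (f : V -> V -> K) (M : set V) : Prop :=
  forall x, M x -> 0 <= f x x.

Definition nonpositive V (f : V -> V -> K) (M : set V) : Prop :=
  forall x, M x -> f x x <= 0.

Definition maximal_nonnegative V (f : V -> V -> K) (L : set V) : Prop :=
  nonnegative f L /\
  forall M, linear_subspace M -> nonnegative f M -> ~ (L `<` M).

Definition maximal_nonpositive V (f : V -> V -> K) (L : set V) : Prop :=
  nonpositive f L /\
  forall M, linear_subspace M -> nonpositive f M -> ~ (L `<` M).

Definition minus_form V (f : V -> V -> K) (p q : V * V) : K :=
  f p.1 q.1 - f p.2 q.2.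

Definition swap_form V (dot : V -> V -> K) (p q : V * V) : K :=
  dot p.1 q.2 + dot p.2 q.1.

(* U^* y is the vector z with (U x, y) = (x, z) for all x; it exists and is
   unique when U is a bounded operator on a Hilbert space. *)
Definition adjoint V (dot : V -> V -> K) (U : V -> V) (y : V) : V :=
  xget 0 [set z | forall x, dot (U x) y = dot x z].

Definition shift_span V (dot : V -> V -> K) (U : V -> V) (g h : V) :
    set (V * V) :=
  lspan (range (fun N : int => (zpow U N g, zpow (adjoint dot U) (- N) h))).

Definition property_A V (dot : V -> V -> K) (U : V -> V) (b0 f0 : V) : Prop :=
  forall g1 h1 : V,
    f0 != 0 ->
    (forall x, sum_set (shift_span dot U b0 f0) (shift_span dot U b0 (- f0)) x ->
       swap_form dot x (g1, h1) = 0) ->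
    (g1, h1) = (0, 0).

(* [nrm] is a norm on the linear subspace D coming from an inner product. *)
Definition prehilbert_norm_on V (D : set V) (nrm : V -> K) : Prop :=
  exists ip : V -> V -> K,
    [/\ hermitian_form_on D ip,
        forall x, D x -> 0 <= nrm x,
        forall x, D x -> ip x x = nrm x ^+ 2 &
        forall x, D x -> nrm x = 0 -> x = 0].

(* Continuity with respect to the norm [nrm] of D. *)
Definition op_continuous_on V (D : set V) (nrm : V -> K) (T : V -> V) : Prop :=
  forall x, D x -> forall e : K, 0 < e -> exists2 d : K, 0 < d &
    forall y, D y -> nrm (y - x) < d -> nrm (T y - T x) < e.

Definition form_continuous_on V (D : set V) (nrm : V -> K) (f : V -> V -> K)
    : Prop :=
  forall x y, D x -> D y -> forall e : K, 0 < e -> exists2 d : K, 0 < d &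
    forall x' y', D x' -> D y' -> nrm (x' - x) < d -> nrm (y' - y) < d ->
      `|f x' y' - f x y| < e.

End Forms.

Section HilbertSpaces.
Context {K : numFieldType} (conj : K -> K).

Definition inner_product (V : normedModType K) (dot : V -> V -> K) : Prop :=
  hermitian_form conj dot /\ forall x, dot x x = `|x| ^+ 2.

Definition bounded_op (V : normedModType K) (T : V -> V) : Prop :=
  exists M : K, forall x, `|T x| <= M * `|x|.

Definition orthonormal_basis (V : normedModType K) (dot : V -> V -> K)
    (b : int -> V) : Prop :=
  (forall m n, dot (b m) (b n) = (m == n)%:R) /\
  closure (lspan (range b)) = [set: V].

(* c belongs to l_2(Z): the finite partial sums of the |c k|^2 are bounded. *)
Definition square_summable (c : int -> K) : Prop :=
  exists M : K, forall s : seq int, uniq s -> \sum_(k <- s) `|c k| ^+ 2 <= M.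

Definition is_weighted_shift (V : normedModType K) (u : int -> K)
    (b : int -> V) (U : V -> V) : Prop :=
  bounded_op U /\ forall n, U (b n) = (u (n + 1) / u n) *: b (n + 1).

(* The Hilbert space E, with iota : D -> E, is the completion of the linear
   subspace D normed by [nrm]. *)
Definition is_completion (V : lmodType K) (D : set V) (nrm : V -> K)
    (E : completeNormedModType K) (iota : V -> E) : Prop :=
  [/\ linear_on D iota,
      forall x, D x -> `|iota x| = nrm x &
      closure (iota @` D) = [set: E]].

End HilbertSpaces.

(* Main.v *)
(* The space H x H with the swap form {(x, y), (x', y')} = (x, y') + (y, x') is
   the required completion.  The operator V (x, y) = (U x, (U^* )^-1 y) is
   unitary for the swap form, and the formula for f_0 makes the swap form of
   (b_0, e f_0) and V^N (b_0, e' f_0), for e, e' = 1 or -1, equal to (e + e')/2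
   times {x_0, U_0^N x_0}_0.  So (U_0^N x_0, 0) |-> V^N (b_0, f_0) and
   (0, U_0^N x_0) |-> V^N (b_0, - f_0) is an isometry for the forms.  It is
   injective because the form on L_{x_0} has no radical (the radical would be a
   neutral invariant subspace), and it has dense range by Property A.
   With D the closed positive diagonal operator D b_n = |u_n|^-2 b_n, one has
   U^* D U = D, so the graphs L_+ of D and L_- of -D are V-invariant; they are
   orthogonal for the swap form, which is positive on L_+ and negative on L_-.
   Exchanging the two coordinates maps L_- to the Hilbert orthocomplement of
   L_+ and does not change the form; this gives both maximality and density. *)
From HB Require Import structures.
Require Import Defs.
From mathcomp Require Import all_boot all_order all_algebra.
From mathcomp Require Import ring complex.
From mathcomp Require Import all_classical all_reals all_analysis.
Import Order.TTheory GRing.Theory Num.Theory.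
Import numFieldNormedType.Exports.
Local Open Scope classical_set_scope.
Local Open Scope ring_scope.

Set Implicit Arguments.
Unset Strict Implicit.
Unset Printing Implicit Defensive.

(** * Real and complex scalars *)

(** Over the complex numbers the order of [K] is partial, but nonnegative elements are real, so
    infima of sets of squared distances make sense in both cases. *)
Definition has_infima (K : numFieldType) : Prop :=
  forall S : set K, S !=set0 -> (forall x, S x -> 0 <= x) ->
  exists m : K, [/\ 0 <= m, forall x, S x -> m <= x &
    forall e, 0 < e -> exists2 x, S x & x < m + e].

Definition has_sqrt (K : numFieldType) : Prop :=
  forall x : K, 0 <= x -> exists2 y, 0 <= y & y ^+ 2 = x.

(** The common interface of the real and complex cases, from which the later arguments proceed.
    [add_conj_le] bounds twice the real part by twice the modulus. *)
Record scalars (K : numFieldType) (conj : K -> K) : Prop := Scalars {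
  conjD : {morph conj : x y / x + y};
  conjM : {morph conj : x y / x * y};
  conj_norm : forall x, conj x * x = `|x| ^+ 2;
  conj_nneg : forall x, 0 <= x -> conj x = x;
  add_conj_le : forall x, x + conj x <= 2 * `|x|;
  infima : has_infima K;
  sqrts : has_sqrt K }.

Lemma has_infima_real (R : realType) : has_infima R.
Proof.
move=> S [s Ss] S0.
have lbS : has_lbound S by exists 0.
exists (inf S); split.
- by apply: lb_le_inf; [exists s|].
- by move=> x Sx; apply: ge_inf.
- by move=> e e0; have [|x Sx xe] := @inf_adherent R S e e0; [split=> //; exists s|exists x].
Qed.

Lemma has_infima_complex (R : realType) : has_infima R[i].
Proof.
move=> S [s Ss] S0.
have eS z : S z -> z = ((complex.Re z)%:C)%C.
  by move=> /S0 /ger0_Im; case: z => a b /= ->.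
have [||m [m0 mS mE]] := @has_infima_real R [set complex.Re z | z in S].
- by exists (complex.Re s), s.
- by move=> _ [z /S0 + <-]; rewrite lecE => /andP[].
exists (m%:C)%C; split.
- by rewrite ler0c.
- by move=> x Sx; rewrite (eS _ Sx) lecR; apply: mS; exists x.
- move=> e e0; have eE : e = ((complex.Re e)%:C)%C.
    by move: (ltW e0) => /ger0_Im; case: (e) => a c /= ->.
  have [|_ [x Sx <-] xe] := mE (complex.Re e); first by move: e0; rewrite ltcE => /andP[].
  by exists x => //; rewrite (eS _ Sx) eE -rmorphD ltcR.
Qed.

Lemma real_or_complex_scalars (K : numFieldType) (conj : K -> K) :
  real_or_complex conj -> scalars conj.
Proof.
case=> R; split=> //.
- by move=> x; rewrite -expr2 real_normK ?num_real.
- by move=> x; rewrite -mulr2n -(mulr_natl x) ler_pM2l// ler_norm.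
- exact: has_infima_real.
- by move=> x x0; exists (Num.sqrt x); rewrite ?sqrtr_ge0 ?sqr_sqrtr.
- exact: rmorphD.
- exact: rmorphM.
- case=> a c; rewrite normc_def -rmorphXn /= sqr_sqrtr ?addr_ge0 ?sqr_ge0//.
  by apply/eqP; rewrite eq_complex/=; apply/andP; split; apply/eqP; ring.
- by move=> x /ger0_Im; case: x => a c /= ->; rewrite oppr0.
- case=> a c; rewrite normc_def /= lecE /=.
  rewrite subrr !addr0 !mul0r addr0 mulr0 eqxx/= subr0 -mulr2n -(mulr_natl a).
  rewrite ler_pM2l// (le_trans (ler_norm _))// -sqrtr_sqr.
  by rewrite ler_sqrt ?addr_ge0 ?sqr_ge0// lerDl sqr_ge0.
- exact: has_infima_complex.
- move=> x x0; have xE : x = ((complex.Re x)%:C)%C.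
    by move: x0 => /ger0_Im; case: (x) => a c /= ->.
  exists ((Num.sqrt (complex.Re x))%:C)%C; first by rewrite ler0c sqrtr_ge0.
  by rewrite -rmorphXn/= sqr_sqrtr; [rewrite -xE|move: x0; rewrite lecE => /andP[]].
Qed.

(** * Epsilon arguments in a partially ordered field, and completeness *)

Section Approximation.
Context {K : numFieldType}.

Lemma le_approx (C x y : K) : 0 <= C -> x \is Num.real -> y \is Num.real ->
  (forall e, 0 < e -> x <= y + C * e) -> x <= y.
Proof.
move=> C0 xr yr H; case: (real_leP xr yr) => // yx.
have d0 : 0 < x - y by rewrite subr_gt0.
have C1 : 0 < C + 1 by rewrite ltr_wpDl.
(* This value of e would give C + 1 <= C. *)
have := H ((x - y) / (C + 1)) (divr_gt0 d0 C1).
rewrite -lerBlDl mulrC mulrAC -mulrA ler_pMr// ler_pdivlMr// mul1r.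
by rewrite gerDl ler10.
Qed.

Lemma ge0_approx0 (C x : K) : 0 <= C -> 0 <= x ->
  (forall e, 0 < e -> x <= C * e) -> x = 0.
Proof.
move=> C0 x0 H; apply/le_anti; rewrite x0 andbT.
by apply: (@le_approx C) => //; [exact: ger0_real|move=> e /H; rewrite add0r].
Qed.

Lemma ex_min_gt0 (x y : K) : 0 < x -> 0 < y ->
  exists2 z, 0 < z & z <= x /\ z <= y.
Proof.
move=> x0 y0; case: (real_leP (gtr0_real x0) (gtr0_real y0)) => xy.
  by exists x.
by exists y => //; split=> //; exact: ltW.
Qed.

Lemma closure_normP (V : normedModType K) (M : set V) (p : V) :
  closure M p <-> forall e : K, 0 < e -> exists2 y, M y & `|p - y| < e.
Proof.
split=> [cM e e0|H B /nbhs_ballP[e e0 eB]].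
  have [y [My]] := cM (ball p e) (nbhsx_ballx p e e0).
  by rewrite -ball_normE => pe; exists y.
have [y My pe] := H e e0; exists y; split=> //; apply: eB.
by rewrite -ball_normE.
Qed.

(** [A e] is to be thought of as the solutions of a problem up to tolerance e. These sets form the
    base of a Cauchy filter, so completeness applies without choosing a sequence. *)
Lemma cauchy_family_cvg (V : completeNormedModType K) (A : K -> set V) :
  (forall e, 0 < e -> A e !=set0) ->
  (forall d e, d <= e -> A d `<=` A e) ->
  (forall e, 0 < e -> exists2 d, 0 < d &
     forall x y, A d x -> A d y -> `|x - y| < e) ->
  exists l : V, forall e, 0 < e -> exists2 d, 0 < d &
     forall x, A d x -> `|l - x| < e.
Proof.
move=> A0 AS AC.
pose F := filter_from [set e : K | 0 < e] A.
have FF : ProperFilter F.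
  apply: filter_from_proper; last by move=> e /A0.
  apply: filter_from_filter; first by exists 1; exact: ltr01.
  move=> i j i0 j0; have [k k0 [ki kj]] := ex_min_gt0 i0 j0.
  by exists k => // x Ax; split; [apply: AS Ax|apply: AS Ax].
have FC : cauchy F.
  apply/cauchy_exP => e e0; have [d d0 dA] := AC e e0.
  have [x Ax] := A0 d d0; exists x; exists d => // y Ay.
  by rewrite -ball_normE; apply: dA.
exists (lim F) => e e0; have Fl := cauchy_cvg F FC.
have /Fl[d d0 dA] := nbhsx_ballx (lim F) e e0.
by exists d => // x /dA; rewrite -ball_normE.
Qed.

End Approximation.

(** * Spans and integer powers *)

Section Spans.
Context {K : numFieldType}.
Implicit Types V W : lmodType K.

Lemma lspan_linear V (S : set V) : linear_subspace (lspan S).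
Proof.
split=> [M [[M0 _] _] //|a x y Sx Sy M MS]; have [[_ Mlin] _] := MS.
by apply: Mlin; [apply: Sx|apply: Sy].
Qed.

Lemma sub_lspan V (S : set V) : S `<=` lspan S.
Proof. by move=> x Sx M [_]; exact. Qed.

Lemma lspan_sub V (S M : set V) :
  linear_subspace M -> S `<=` M -> lspan S `<=` M.
Proof. by move=> Mlin SM x; apply. Qed.

Section Subspace.
Variables (V : lmodType K) (M : set V) (Mlin : linear_subspace M).

Lemma subspace0 : M 0. Proof. by case: Mlin. Qed.

Lemma subspaceD x y : M x -> M y -> M (x + y).
Proof. by move=> Mx My; rewrite -[x]scale1r; case: Mlin => _; apply. Qed.

Lemma subspaceZ a x : M x -> M (a *: x).
Proof.
by move=> Mx; rewrite -[_ *: _]addr0; case: Mlin => M0; apply => //.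
Qed.

Lemma subspaceB x y : M x -> M y -> M (x - y).
Proof.
by move=> Mx My; rewrite -scaleN1r addrC; case: Mlin => _; apply.
Qed.

End Subspace.

(** Every duplicate-free list containing [s] is allowed, so that several combinations can be written
    over a common list of indices. *)
Lemma lspan_rangeP V (v : int -> V) x : lspan (range v) x ->
  exists s : seq int, forall s', uniq s' -> {subset s <= s'} ->
  exists c : int -> K, x = \sum_(k <- s') c k *: v k.
Proof.
apply: (@lspan_sub V (range v) [set x | exists s : seq int, forall s',
  uniq s' -> {subset s <= s'} ->
  exists c : int -> K, x = \sum_(k <- s') c k *: v k]).
- split.
    exists [::] => s' _ _; exists (fun=> 0).
    by rewrite big1// => k _; rewrite scale0r.
  move=> a {}x y [s1 H1] [s2 H2]; exists (s1 ++ s2) => s' us' ss'.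
  have [|c1 ->] := H1 s' us'; first by move=> k ks; apply: ss'; rewrite mem_cat ks.
  have [|c2 ->] := H2 s' us'; first by move=> k ks; apply: ss'; rewrite mem_cat ks orbT.
  exists (fun k => a * c1 k + c2 k); rewrite scaler_sumr -big_split/=.
  by apply: eq_bigr => k _; rewrite scalerA scalerDl.
- move=> _ [k _ <-]; exists [:: k] => s' us' ks'.
  exists (fun j => (j == k)%:R).
  rewrite (bigD1_seq k)//=; last by rewrite ks' ?mem_head.
  by rewrite eqxx scale1r big1 ?addr0// => j /negPf ->; rewrite scale0r.
Qed.

(** The map is read off its graph [G], the span of the pairs (v k, w k); independence of [v] makes
    [G] single-valued. *)
Lemma lin_indep_extend V W (v : int -> V) (w : int -> W) :
  lin_indep_family v ->
  exists phi : V -> W, linear_on (lspan (range v)) phi /\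
    forall k, phi (v k) = w k.
Proof.
move=> vfree; pose G := lspan (range (fun k => (v k, w k))).
have Glin : linear_subspace G := lspan_linear _.
have G_fun x z1 z2 : G (x, z1) -> G (x, z2) -> z1 = z2.
  move=> Gz1 Gz2; apply/eqP; rewrite -subr_eq0; apply/eqP.
  have := subspaceB Glin Gz1 Gz2.
  move=> /lspan_rangeP[s /(_ _ (undup_uniq s))[|c]].
    by move=> k; rewrite mem_undup.
  move=> Ec; have E1 : \sum_(k <- undup s) c k *: v k = 0.
    by have := congr1 fst Ec; rewrite /= subrr (raddf_sum fst).
  have -> : z1 - z2 = \sum_(k <- undup s) c k *: w k.
    by have := congr1 snd Ec; rewrite /= (raddf_sum snd).
  rewrite big_seq big1// => k ks.
  by rewrite (vfree _ _ (undup_uniq s) E1 k ks) scale0r.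
have G_total x : lspan (range v) x -> exists z, G (x, z).
  apply: (@lspan_sub V (range v) [set x | exists z, G (x, z)]) => [|_ [k _ <-]].
    split; first by exists 0; exact: (subspace0 Glin).
    move=> a {}x y [z Gz] [z' Gz']; exists (a *: z + z').
    by case: Glin => _ /(_ a _ _ Gz Gz').
  by exists (w k); apply: sub_lspan; exists k.
pose phi x := xget 0 [set z | G (x, z)].
have phiP x : lspan (range v) x -> G (x, phi x).
  by move=> /G_total[z Gz]; exact: (@xgetPex _ 0 [set z | G (x, z)] (ex_intro _ z Gz)).
exists phi; split=> [a x y Sx Sy|k].
  apply: (G_fun (a *: x + y)).
    by apply: phiP; case: (lspan_linear (range v)) => _; apply.
  exact: (Glin.2 a _ _ (phiP _ Sx) (phiP _ Sy)).
apply: (G_fun (v k)); last by apply: sub_lspan; exists k.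
by apply: phiP; apply: sub_lspan; exists k.
Qed.

End Spans.

Section IntegerPowers.
Context {K : numFieldType} {V : lmodType K}.
Implicit Types T : V -> V.

Lemma inv_opK T : bijective T -> cancel T (inv_op T).
Proof.
move=> bT x; apply: pinvKV; last by rewrite inE.
by move=> ? ? _ _; exact: bij_inj.
Qed.

Lemma inv_opVK T : bijective T -> cancel (inv_op T) T.
Proof.
move=> bT; have [S TK SK] := bT => x.
by rewrite -[x in inv_op _ x]SK inv_opK// SK.
Qed.

Lemma inv_op_eq T S : cancel T S -> cancel S T -> inv_op T = S.
Proof.
move=> TK SK; have bT : bijective T by exists S.
by apply/funext => x; rewrite -[x in LHS]SK inv_opK.
Qed.

Lemma bij_inv_op T : bijective T -> bijective (inv_op T).
Proof. by move=> bT; exists T; [exact: inv_opVK|exact: inv_opK]. Qed.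

Lemma zpowS T : bijective T -> forall N x, zpow T (N + 1) x = T (zpow T N x).
Proof.
move=> bT [n|[|n]] x.
- by rewrite -PoszD addn1.
- by rewrite /= inv_opVK.
- have -> : Negz n.+1 + 1 = Negz n by rewrite !NegzE; ring.
  by rewrite [zpow T (Negz n.+1) x]iterS inv_opVK.
Qed.

Lemma zpowB1 T : bijective T ->
  forall N x, zpow T (N - 1) x = inv_op T (zpow T N x).
Proof.
by move=> bT N x; rewrite -[in RHS](subrK 1 N) zpowS// inv_opK.
Qed.

Lemma zpow_inv T : bijective T -> forall N x, zpow (inv_op T) N x = zpow T (- N) x.
Proof.
move=> bT; have bS := bij_inv_op bT.
have invI : inv_op (inv_op T) = T.
  by apply: inv_op_eq; [exact: inv_opVK|exact: inv_opK].
elim/int_rec => [x|n IH x|n IH x]; first by rewrite oppr0.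
- rewrite -addn1 PoszD opprD zpowB1// -IH.
  by rewrite [LHS](zpowS bS).
- by rewrite -addn1 PoszD opprK opprD (zpowB1 bS) invI IH opprK zpowS.
Qed.

Lemma zpowD T : bijective T ->
  forall M N x, zpow T (M + N) x = zpow T M (zpow T N x).
Proof.
move=> bT; elim/int_rec => [N x|n IH N x|n IH N x]; first by rewrite add0r.
- by rewrite -addn1 PoszD addrAC !zpowS// IH.
- by rewrite -addn1 PoszD opprD addrAC !zpowB1// IH.
Qed.

End IntegerPowers.

(** * Hermitian forms and the projection theorem *)

Section Conjugation.
Context {K : numFieldType} {conj : K -> K} (hs : scalars conj).

Lemma conj0 : conj 0 = 0. Proof. exact: (conj_nneg hs (lexx 0)). Qed.

Lemma conj1 : conj 1 = 1. Proof. exact: (conj_nneg hs ler01). Qed.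

Lemma conjN x : conj (- x) = - conj x.
Proof.
by apply/eqP; rewrite -subr_eq0 opprK -(conjD hs) addNr conj0.
Qed.

Lemma norm_conj x : `|conj x| = `|x|.
Proof.
have [->|x0] := eqVneq x 0; first by rewrite conj0.
have := congr1 Num.norm (conj_norm hs x).
by rewrite normrM normrX normr_id expr2; apply: mulIf; rewrite normr_eq0.
Qed.

Lemma conj_eq0 x : (conj x == 0) = (x == 0).
Proof. by rewrite -normr_eq0 norm_conj normr_eq0. Qed.

(** Compare [conj_norm] at x and at [conj x], which have the same norm, and cancel the common factor
    [conj x]. *)
Lemma conjK : involutive conj.
Proof.
move=> x; have [->|x0] := eqVneq x 0; first by rewrite !conj0.
have := conj_norm hs (conj x); rewrite norm_conj -(conj_norm hs x) mulrC.
by apply: mulfI; rewrite conj_eq0.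
Qed.

Lemma conjV x : conj x^-1 = (conj x)^-1.
Proof.
have [->|x0] := eqVneq x 0; first by rewrite invr0 conj0 invr0.
apply: (@mulIf _ (conj x)); first by rewrite conj_eq0.
by rewrite -(conjM hs) !mulVf ?conj_eq0// conj1.
Qed.

Section Form.
Context {V : lmodType K} {f : V -> V -> K} (hf : hermitian_form conj f).

Lemma formC x y : f y x = conj (f x y).
Proof. by case: hf => _; apply. Qed.

Lemma formPr x a y z : f x (a *: y + z) = a * f x y + f x z.
Proof. by case: hf => /(_ x I) H _; rewrite H. Qed.

Lemma formDr x y z : f x (y + z) = f x y + f x z.
Proof. by rewrite -[y in LHS]scale1r formPr mul1r. Qed.

Lemma form0r x : f x 0 = 0.
Proof. by apply: (@addrI _ (f x 0)); rewrite -formDr !addr0. Qed.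

Lemma formZr x a y : f x (a *: y) = a * f x y.
Proof. by rewrite -[_ *: _]addr0 formPr form0r addr0. Qed.

Lemma formNr x y : f x (- y) = - f x y.
Proof. by rewrite -scaleN1r formZr mulN1r. Qed.

Lemma formBr x y z : f x (y - z) = f x y - f x z.
Proof. by rewrite formDr formNr. Qed.

Lemma formDl x y z : f (x + y) z = f x z + f y z.
Proof. by rewrite formC formDr (conjD hs) -!formC. Qed.

Lemma form0l x : f 0 x = 0. Proof. by rewrite formC form0r conj0. Qed.

Lemma formZl a x y : f (a *: x) y = conj a * f x y.
Proof. by rewrite formC formZr (conjM hs) -formC. Qed.

Lemma formNl x y : f (- x) y = - f x y.
Proof. by rewrite formC formNr conjN -formC. Qed.

Lemma formBl x y z : f (x - y) z = f x z - f y z.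
Proof. by rewrite formDl formNl. Qed.

Lemma form_sumr I (s : seq I) (F : I -> V) x :
  f x (\sum_(i <- s) F i) = \sum_(i <- s) f x (F i).
Proof. exact: (big_morph _ (formDr x) (form0r x)). Qed.

Lemma form_suml I (s : seq I) (F : I -> V) x :
  f (\sum_(i <- s) F i) x = \sum_(i <- s) f (F i) x.
Proof. exact: (big_morph (f^~ x) (fun y z => formDl y z x) (form0l x)). Qed.

Lemma unitary_zpow (T : V -> V) : form_unitary f T ->
  forall N x y, f (zpow T N x) (zpow T N y) = f x y.
Proof.
case=> bT TT SS; elim/int_rec => // n IH x y.
  by rewrite -addn1 PoszD !zpowS// TT IH.
by rewrite -addn1 PoszD opprD !zpowB1// SS IH.
Qed.

(** Gram matrices along orbits are Toeplitz: the row of exponent 0 determines them. *)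
Lemma unitary_zpowC (T : V -> V) : form_unitary f T ->
  forall M N x y, f (zpow T M x) (zpow T N y) = f x (zpow T (N - M) y).
Proof.
move=> uT M N x y; have [bT _ _] := uT.
have -> : zpow T N y = zpow T M (zpow T (N - M) y).
  by rewrite -zpowD// addrC subrK.
by rewrite unitary_zpow.
Qed.

End Form.
End Conjugation.

Section InnerProduct.
Context {K : numFieldType} {conj : K -> K} (hs : scalars conj).
Context {V : normedModType K} {dot : V -> V -> K}.
Hypothesis hdot : inner_product conj dot.
Let hf : hermitian_form conj dot := hdot.1.

Lemma dotxx x : dot x x = `|x| ^+ 2. Proof. by case: hdot. Qed.

Lemma dot_eq0 x : dot x x = 0 -> x = 0.
Proof. by rewrite dotxx => /eqP; rewrite sqrf_eq0 normr_eq0 => /eqP. Qed.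

Lemma normD2 x y : `|x + y| ^+ 2 = `|x| ^+ 2 + `|y| ^+ 2 + (dot x y + dot y x).
Proof.
by rewrite -!dotxx (formDl hs hf) !(formDr hf); ring.
Qed.

Lemma normB2 x y : `|x - y| ^+ 2 = `|x| ^+ 2 + `|y| ^+ 2 - (dot x y + dot y x).
Proof. by rewrite normD2 normrN (formNl hs hf) (formNr hf) -opprD. Qed.

Lemma parallelogram (x y : V) :
  `|x + y| ^+ 2 + `|x - y| ^+ 2 = 2 * `|x| ^+ 2 + 2 * `|y| ^+ 2.
Proof. by rewrite normB2 normD2; ring. Qed.

Lemma pythagoras (x y : V) : dot x y = 0 -> `|x + y| ^+ 2 = `|x| ^+ 2 + `|y| ^+ 2.
Proof. by move=> H; rewrite normD2 (formC hf x y) H (conj0 hs) !addr0. Qed.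

(** The subtracted vector is the projection of x on the line of y. The identity yields both
    Cauchy-Schwarz and [dist_minimizing]. *)
Lemma norm_sub_proj (x y : V) : y != 0 ->
  `|x - (dot y x / `|y| ^+ 2) *: y| ^+ 2 = `|x| ^+ 2 - `|dot y x| ^+ 2 / `|y| ^+ 2.
Proof.
move=> y0; have ny : `|y| != 0 by rewrite normr_eq0.
have cn : conj (`|y| ^+ 2) = `|y| ^+ 2 by rewrite conj_nneg// exprn_ge0.
rewrite normB2 (formZl hs hf) (formZr hf) (conjM hs) (conjV hs) cn.
rewrite (formC hf y x) -(conj_norm hs (dot y x)) normrZ exprMn.
rewrite normrM normfV normrX normr_id exprMn -(conj_norm hs (dot y x)).
by field.
Qed.

Lemma cauchy_schwarz x y : `|dot x y| <= `|x| * `|y|.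
Proof.
have [->|x0] := eqVneq x 0; first by rewrite (form0l hs hf) !normr0 mul0r.
rewrite -(@ler_pXn2r _ 2)// ?nnegrE ?mulr_ge0// exprMn mulrC.
rewrite -ler_pdivrMr ?exprn_gt0 ?normr_gt0//.
by rewrite -subr_ge0 -norm_sub_proj// exprn_ge0.
Qed.

(** Moving y along x by the component of p - y lowers the squared distance by |dot x (p - y)|^2 /
    |x|^2, while it exceeds its lower bound d by less than e. *)
Lemma dist_minimizing (M : set V) (p : V) (d e : K) (y x : V) :
  linear_subspace M -> (forall z, M z -> d <= `|p - z| ^+ 2) ->
  M y -> `|p - y| ^+ 2 < d + e -> M x -> `|dot x (p - y)| ^+ 2 <= e * `|x| ^+ 2.
Proof.
move=> Mlin dM My ye Mx.
have [->|x0] := eqVneq x 0; first by rewrite (form0l hs hf) !normr0 !expr0n/= mulr0.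
rewrite -ler_pdivrMr ?exprn_gt0 ?normr_gt0//.
have /dM : M (y + (dot x (p - y) / `|x| ^+ 2) *: x).
  by apply: subspaceD => //; exact: subspaceZ.
rewrite opprD addrA norm_sub_proj// lerBrDr => /le_lt_trans/(_ ye).
by rewrite ltrD2l => /ltW.
Qed.

End InnerProduct.

Section Projection.
Context {K : numFieldType} {conj : K -> K} (hs : scalars conj).
Context {V : completeNormedModType K} {dot : V -> V -> K}.
Hypothesis hdot : inner_product conj dot.
Let hf : hermitian_form conj dot := hdot.1.

(** Near-minimizers of the distance form a Cauchy family by the parallelogram law and are nearly
    orthogonal to [M] by [dist_minimizing]; the limit m is in the closure of [M]. *)
Lemma projection (M : set V) (p : V) : linear_subspace M ->
  exists2 m, closure M m & forall x, M x -> dot x (p - m) = 0.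
Proof.
move=> Mlin.
have [||d [d0 dM dE]] := infima hs (S := [set `|p - y| ^+ 2 | y in M]).
- by exists (`|p - 0| ^+ 2), 0 => //; exact: subspace0.
- by move=> _ [y _ <-]; rewrite exprn_ge0.
have {}dM y : M y -> d <= `|p - y| ^+ 2 by move=> My; apply: dM; exists y.
pose A (e : K) := [set y | M y /\ `|p - y| ^+ 2 < d + e].
have [|||m mA] := @cauchy_family_cvg _ V A.
- by move=> e /dE[_ [y My <-] ye]; exists y.
- by move=> d' e de y [My yd]; split=> //; rewrite (lt_le_trans yd)// lerD2l.
(* The midpoint of x and y is in [M], at squared distance at least d from p, so |x - y|^2 < 4 (d +
   e^2 / 4) - 4 d = e^2. *)
- move=> e e0; exists (e ^+ 2 / 4); first by rewrite divr_gt0 ?exprn_gt0.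
  move=> x y [Mx xd] [My yd].
  have := parallelogram hs hdot (p - y) (p - x).
  have -> : p - y - (p - x) = x - y by rewrite opprB addrC addrA subrK.
  have -> : p - y + (p - x) = 2 *: (p - 2^-1 *: (x + y)).
    rewrite scalerBr scalerA divff ?pnatr_eq0// scale1r scaler_nat mulr2n.
    by rewrite opprD addrACA [- y - x]addrC -opprD.
  rewrite normrZ exprMn normr_nat => E.
  have /dM h : M (2^-1 *: (x + y)) by apply: subspaceZ => //; exact: subspaceD.
  rewrite -(@ltr_pXn2r _ 2)// ?nnegrE//; last exact: ltW.
  have {}E : `|x - y| ^+ 2 = 2 * `|p - y| ^+ 2 + 2 * `|p - x| ^+ 2
                             - 2 ^+ 2 * `|p - 2^-1 *: (x + y)| ^+ 2.
    by rewrite -E [RHS]addrC addKr.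
  rewrite E ltrBlDr.
  have -> : e ^+ 2 = 2 * (e ^+ 2 / 4) + 2 * (e ^+ 2 / 4) by field.
  apply: (@lt_le_trans _ _ (2 * (d + e ^+ 2 / 4) + 2 * (d + e ^+ 2 / 4))).
    by apply: ltrD; rewrite ltr_pM2l.
  rewrite -subr_ge0.
  set z := `|p - _| ^+ 2.
  have -> : 2 * (e ^+ 2 / 4) + 2 * (e ^+ 2 / 4) + 2 ^+ 2 * z -
    (2 * (d + e ^+ 2 / 4) + 2 * (d + e ^+ 2 / 4)) = 2 ^+ 2 * (z - d) by ring.
  by rewrite mulr_ge0 ?exprn_ge0// subr_ge0.
exists m.
  apply/closure_normP => e /mA[d' d'0 dA].
  have [_ [y My <-] yd] := dE _ d'0.
  by exists y => //; apply: dA; split.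
move=> x Mx; apply/eqP; rewrite -normr_eq0; apply/eqP.
apply: (@ge0_approx0 _ (2 * `|x|)) => //.
move=> e e0; have [d' d'0 dA] := mA e e0.
(* d'' <= d' puts y within e of m, and d'' <= e^2 gives |dot x (p - y)| <= e |x|; the two errors
   make up the factor 2. *)
have [d'' d''0 [dd' de]] := ex_min_gt0 d'0 (exprn_gt0 2 e0).
have [_ [y My <-] yd] := dE _ d''0.
have my : `|m - y| < e.
  by apply: dA; split=> //; rewrite (lt_le_trans yd)// lerD2l.
have -> : p - m = (p - y) - (m - y) by rewrite opprB addrA subrK.
rewrite (formBr hf) (le_trans (ler_normB _ _))// mulrAC mulrDl mul1r mulrDl lerD//.
  rewrite -(@ler_pXn2r _ 2)// ?nnegrE ?mulr_ge0 ?(ltW e0)// exprMn.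
  rewrite (le_trans (dist_minimizing hs hdot Mlin dM My yd Mx))//.
  by rewrite ler_wpM2r ?exprn_ge0.
rewrite (le_trans (cauchy_schwarz hs hdot _ _))// mulrC.
by rewrite ler_wpM2r// ltW.
Qed.

Lemma orth_dense (M : set V) : linear_subspace M ->
  (forall q, (forall x, M x -> dot x q = 0) -> q = 0) ->
  closure M = [set: V].
Proof.
move=> Mlin M0; apply/seteqP; split=> // p _.
have [m cm /M0 /eqP] := projection p Mlin.
by rewrite subr_eq0 => /eqP ->.
Qed.

(** The representing vector is a multiple of q, the component orthogonal to the kernel of some p
    outside the kernel. *)
Lemma riesz (phi : V -> K) (C : K) :
  (forall a x y, phi (a *: x + y) = a * phi x + phi y) ->
  (forall x, `|phi x| <= C * `|x|) -> exists z, forall x, phi x = dot z x.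
Proof.
move=> phil phiC.
have phi0 : phi 0 = 0.
  by have := phil 1 0 0; rewrite scale1r addr0 mul1r -[LHS]addr0 => /addrI.
have [all0|] := pselect (forall x, phi x = 0).
  by exists 0 => x; rewrite all0 (form0l hs hf).
move=> /existsNP[p /eqP p0].
have klin : linear_subspace [set x | phi x = 0].
  by split=> // a x y /= x0 y0; rewrite phil x0 y0 mulr0 addr0.
have [m /closure_normP cm orth] := projection p klin.
have phiB x y : phi (x - y) = phi x - phi y.
  by rewrite -scaleN1r addrC phil mulN1r addrC.
have p_gt0 : 0 < `|p| by rewrite normr_gt0; apply: contraNneq p0 => ->; rewrite phi0.
have C0 : 0 <= C.
  by rewrite -(pmulr_lge0 _ p_gt0) (le_trans _ (phiC p)).
(* The projection m is known to lie in the closure of the kernel; the bound on [phi] puts it in the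
   kernel. *)
have m0 : phi m = 0.
  apply/eqP; rewrite -normr_eq0; apply/eqP; apply: (@ge0_approx0 _ C) => // e e0.
  have [y y0 my] := cm e e0.
  have -> : phi m = phi (m - y) by rewrite phiB y0 subr0.
  by rewrite (le_trans (phiC _))// ler_wpM2l// ltW.
pose q := p - m.
have phq : phi q = phi p by rewrite phiB m0 subr0.
have q0 : q != 0 by apply: contra p0 => /eqP q0; rewrite -phq q0 phi0.
have nq0 : `|q| ^+ 2 != 0 by rewrite sqrf_eq0 normr_eq0.
exists ((conj (phi q / `|q| ^+ 2)) *: q) => x.
rewrite (formZl hs hf) (conjK hs).
(* The first argument lies in the kernel; solving this equation for [phi x] gives the chosen
   multiple of q. *)
have : dot (x - (phi x / phi q) *: q) q = 0.
  by apply: orth; rewrite /= -scaleNr addrC phil; field; rewrite phq.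
rewrite (formC hf) => /eqP; rewrite (conj_eq0 hs) (formBr hf) (formZr hf) (dotxx hdot).
rewrite subr_eq0 => /eqP ->; field.
by rewrite phq p0 sqrf_eq0 in nq0 *.
Qed.

End Projection.

(** * The Hilbert sum of two spaces *)

(* [l2prod hr V W] is V * W with the norm sqrt (|v|^2 + |w|^2); the parameter
   hr provides the square roots, which a general [numFieldType] lacks. *)
Definition l2prod (K : numFieldType) (hr : has_sqrt K) (V W : normedModType K)
  : Type := (V * W)%type.

Section L2Product.
Context {K : numFieldType} (hr : has_sqrt K).

Section Norm.
Context (V W : normedModType K).
Local Notation E := (l2prod hr V W).

HB.instance Definition _ := GRing.Lmodule.copy E (V * W)%type.

Definition l2norm (p : E) : K :=
  xget 0 [set r | 0 <= r /\ r ^+ 2 = `|p.1| ^+ 2 + `|p.2| ^+ 2].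

Lemma l2normP p : 0 <= l2norm p /\ l2norm p ^+ 2 = `|p.1| ^+ 2 + `|p.2| ^+ 2.
Proof.
have [|r r0 rE] := hr (x := `|p.1| ^+ 2 + `|p.2| ^+ 2).
  by rewrite addr_ge0 ?exprn_ge0.
exact: (@xgetPex _ 0 [set r | 0 <= r /\ r ^+ 2 = `|p.1| ^+ 2 + `|p.2| ^+ 2]
  (ex_intro _ r (conj r0 rE))).
Qed.

Lemma l2norm_ge0 p : 0 <= l2norm p. Proof. by case: (l2normP p). Qed.

Lemma sqr_l2norm p : l2norm p ^+ 2 = `|p.1| ^+ 2 + `|p.2| ^+ 2.
Proof. by case: (l2normP p). Qed.

Lemma l2norm_le r p : 0 <= r -> (l2norm p <= r) = (`|p.1| ^+ 2 + `|p.2| ^+ 2 <= r ^+ 2).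
Proof.
by move=> r0; rewrite -sqr_l2norm ler_pXn2r// nnegrE// l2norm_ge0.
Qed.

Lemma ler_l2normD p q : l2norm (p + q) <= l2norm p + l2norm q.
Proof.
rewrite l2norm_le ?addr_ge0 ?l2norm_ge0//=.
apply: (@le_trans _ _ ((`|p.1| + `|q.1|) ^+ 2 + (`|p.2| + `|q.2|) ^+ 2)).
  by apply: lerD; rewrite ler_pXn2r// ?nnegrE ?addr_ge0// ler_normD.
have -> : (l2norm p + l2norm q) ^+ 2 =
    l2norm p ^+ 2 + l2norm q ^+ 2 + 2 * (l2norm p * l2norm q) by ring.
rewrite !sqr_l2norm.
have -> : (`|p.1| + `|q.1|) ^+ 2 + (`|p.2| + `|q.2|) ^+ 2 =
    `|p.1| ^+ 2 + `|p.2| ^+ 2 + (`|q.1| ^+ 2 + `|q.2| ^+ 2) +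
    2 * (`|p.1| * `|q.1| + `|p.2| * `|q.2|) by ring.
rewrite lerD2l ler_pM2l// -(@ler_pXn2r _ 2)// ?nnegrE ?addr_ge0 ?mulr_ge0 ?l2norm_ge0//.
rewrite exprMn !sqr_l2norm -subr_ge0.
(* Lagrange's identity: the defect of Cauchy-Schwarz in the plane is a square. *)
have -> : (`|p.1| ^+ 2 + `|p.2| ^+ 2) * (`|q.1| ^+ 2 + `|q.2| ^+ 2) -
    (`|p.1| * `|q.1| + `|p.2| * `|q.2|) ^+ 2 =
    (`|p.1| * `|q.2| - `|p.2| * `|q.1|) ^+ 2 by ring.
by rewrite real_exprn_even_ge0// realB// realM// normr_real.
Qed.

Lemma l2normZ (a : K) p : l2norm (a *: p) = `|a| * l2norm p.
Proof.
apply/eqP; rewrite -(@eqrXn2 _ 2) ?mulr_ge0 ?l2norm_ge0//.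
by rewrite exprMn !sqr_l2norm /= !normrZ !exprMn mulrDr.
Qed.

Lemma l2norm_eq0 p : l2norm p = 0 -> p = 0.
Proof.
move=> p0; have := sqr_l2norm p; rewrite p0 expr0n/= => /esym/eqP.
rewrite paddr_eq0 ?exprn_ge0// !sqrf_eq0 !normr_eq0.
by case: p {p0} => x y /= /andP[/eqP -> /eqP ->].
Qed.

HB.instance Definition _ := Lmodule_isNormed.Build K E
  ler_l2normD l2normZ l2norm_eq0.

Lemma l2prod_norm2 (p : E) : `|p| ^+ 2 = `|p.1| ^+ 2 + `|p.2| ^+ 2.
Proof. exact: sqr_l2norm. Qed.

Lemma norm_fst_le (p : E) : `|p.1| <= `|p|.
Proof.
by rewrite -(@ler_pXn2r _ 2)// ?nnegrE// l2prod_norm2 lerDl exprn_ge0.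
Qed.

Lemma norm_snd_le (p : E) : `|p.2| <= `|p|.
Proof.
by rewrite -(@ler_pXn2r _ 2)// ?nnegrE// l2prod_norm2 lerDr exprn_ge0.
Qed.

Lemma l2prod_norm_le (p : E) : `|p| <= `|p.1| + `|p.2|.
Proof.
rewrite -(@ler_pXn2r _ 2)// ?nnegrE ?addr_ge0// l2prod_norm2 sqrrD.
by rewrite addrAC lerDl mulrn_wge0// mulr_ge0.
Qed.

End Norm.

Section Complete.
Context (V W : completeNormedModType K).
Local Notation E := (l2prod hr V W).

Lemma l2prod_complete (F : set_system E) : ProperFilter F -> cauchy F -> cvg F.
Proof.
move=> FF /cauchyP Fc.
have F1 : cauchy ((fst : E -> V) @ F).
  apply/cauchy_exP => e e0; have [p Fp] := Fc e e0.
  exists p.1; change (F [set q : E | ball p.1 e q.1]).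
  apply: filterS Fp => q; rewrite -ball_normE /= -ball_normE.
  exact: (le_lt_trans (norm_fst_le (p - q))).
have F2 : cauchy ((snd : E -> W) @ F).
  apply/cauchy_exP => e e0; have [p Fp] := Fc e e0.
  exists p.2; change (F [set q : E | ball p.2 e q.2]).
  apply: filterS Fp => q; rewrite -ball_normE /= -ball_normE.
  exact: (le_lt_trans (norm_snd_le (p - q))).
have c1 : cvg ((fst : E -> V) @ F) by exact: cauchy_cvg F1.
have c2 : cvg ((snd : E -> W) @ F) by exact: cauchy_cvg F2.
pose l : E := (lim ((fst : E -> V) @ F), lim ((snd : E -> W) @ F)).
apply/cvg_ex; exists l => A /nbhs_ballP[e e0 eA].
have e2 : 0 < e / 2 by rewrite divr_gt0.
have {}c1 := c1 _ (nbhsx_ballx l.1 (e / 2) e2).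
have {}c2 := c2 _ (nbhsx_ballx l.2 (e / 2) e2).
change (F [set q : E | ball l.1 (e / 2) q.1]) in c1.
change (F [set q : E | ball l.2 (e / 2) q.2]) in c2.
apply: filterS (filterI c1 c2) => q [q1 q2]; apply: eA.
move: q1 q2; rewrite -!ball_normE/= => q1 q2.
by rewrite (le_lt_trans (l2prod_norm_le (l - q)))// (splitr e) ltrD.
Qed.

HB.instance Definition _ := Uniform_isComplete.Build E l2prod_complete.

End Complete.

Lemma l2prod_inner (conj : K -> K) (hs : scalars conj) (V W : normedModType K)
    (dV : V -> V -> K) (dW : W -> W -> K) :
  inner_product conj dV -> inner_product conj dW ->
  inner_product conj (fun p q : l2prod hr V W => dV p.1 q.1 + dW p.2 q.2).
Proof.
move=> hV hW; split; last by move=> p; rewrite l2prod_norm2 -(dotxx hV) -(dotxx hW).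
split=> [p _ a q r _ _|p q _ _] /=.
  by rewrite (formPr hV.1) (formPr hW.1) addrACA -mulrDr.
by rewrite (conjD hs) -(formC hV.1) -(formC hW.1).
Qed.

End L2Product.

(** * Adjoints and orthonormal bases *)

Section InverseOperators.
Context {K : numFieldType}.

Lemma inv_op_linear (V : lmodType K) (T : V -> V) :
  linear T -> bijective T -> linear (inv_op T).
Proof.
move=> Tlin bT a x y; apply: (bij_inj bT).
by rewrite Tlin !inv_opVK.
Qed.

Lemma zpow_prod (V W : lmodType K) (S : V -> V) (T : W -> W) :
  bijective S -> bijective T ->
  let ST := fun p : V * W => (S p.1, T p.2) in
  [/\ bijective ST,
      inv_op ST = (fun p => (inv_op S p.1, inv_op T p.2)) &
      forall N p, zpow ST N p = (zpow S N p.1, zpow T N p.2)].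
Proof.
move=> bS bT ST.
have K1 : cancel ST (fun p => (inv_op S p.1, inv_op T p.2)).
  by case=> x y; rewrite /ST/= !inv_opK.
have K2 : cancel (fun p => (inv_op S p.1, inv_op T p.2)) ST.
  by case=> x y; rewrite /ST/= !inv_opVK.
have bST : bijective ST by exists (fun p => (inv_op S p.1, inv_op T p.2)).
have iST := inv_op_eq K1 K2; split=> //.
elim/int_rec => [[x y] //|n IH p|n IH p].
  by rewrite -addn1 PoszD !zpowS// IH.
by rewrite -addn1 PoszD opprD !zpowB1// IH iST.
Qed.

(** In the zero space every [M] is a bound, even a negative or non-real one, so 1 is taken there.
    Otherwise a nonzero vector forces M >= 0 and M + 1 serves. *)
Lemma bounded_op_gt0 (V : normedModType K) (T : V -> V) :
  bounded_op T -> exists2 M, 0 < M & forall x, `|T x| <= M * `|x|.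
Proof.
case=> M HM; have [V0|] := pselect (forall x : V, x = 0).
  by exists 1 => // x; rewrite (V0 (T x)) normr0 mulr_ge0.
move=> /existsNP[x /eqP x0].
have M0 : 0 <= M.
  by rewrite -(@pmulr_lge0 _ `|x|) ?normr_gt0// (le_trans _ (HM x)).
exists (M + 1); first by rewrite ltr_wpDl.
by move=> y; rewrite (le_trans (HM y))// ler_wpM2r// lerDl.
Qed.

(** Approximate solutions of T x = y exist by density and form a Cauchy family by the lower bound;
    boundedness of [T] shows that their limit solves the equation exactly. *)
Lemma bounded_below_surjective (V : completeNormedModType K) (T : V -> V)
    (C : K) :
  linear T -> bounded_op T -> 0 < C -> (forall x, `|x| <= C * `|T x|) ->
  closure (range T) = [set: V] -> forall y, exists x, T x = y.
Proof.
move=> Tlin /bounded_op_gt0[M M0 TM] C0 TC Tdense y.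
have TB x z : T (x - z) = T x - T z.
  by rewrite -scaleN1r addrC Tlin scaleN1r addrC.
have near e : 0 < e -> exists x, `|y - T x| < e.
  have /closure_normP cy : closure (range T) y by rewrite Tdense.
  by move=> /cy[_ [x _ <-] xe]; exists x.
have [||e e0|l lP] := @cauchy_family_cvg _ V (fun e => [set x | `|y - T x| < e]).
- by move=> e /near[x xe]; exists x.
- by move=> d e de x /= xd; apply: lt_le_trans de.
- exists (e / (2 * C)); first by rewrite divr_gt0// mulr_gt0.
  move=> x z /= xe ze; rewrite (le_lt_trans (TC _))// TB mulrC -ltr_pdivlMr//.
  rewrite distrC in xe; rewrite -(subrK y (T x)) -addrA (le_lt_trans (ler_normD _ _))//.
  have -> : e / C = e / (2 * C) + e / (2 * C) by field; rewrite gt_eqF.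
  exact: ltrD.
exists l; apply/eqP; rewrite -subr_eq0 -normr_eq0; apply/eqP.
apply: (@ge0_approx0 _ (M + 1)) => //; first by rewrite addr_ge0// ltW.
move=> e e0; have [d d0 dP] := lP e e0.
have [z z0 [zd ze]] := ex_min_gt0 d0 e0; have [x xz] := near z z0.
rewrite -(subrK (T x) (T l)) -addrA (le_trans (ler_normD _ _))// mulrDl mul1r lerD//.
  rewrite -TB (le_trans (TM _))// ler_wpM2l ?(ltW M0)// ltW// dP//=.
  exact: lt_le_trans zd.
by rewrite distrC ltW// (lt_le_trans xz).
Qed.

End InverseOperators.

Section Adjoint.
Context {K : numFieldType} {conj : K -> K} (hs : scalars conj).
Context {V : completeNormedModType K} {dot : V -> V -> K}.
Hypothesis hdot : inner_product conj dot.
Let hf : hermitian_form conj dot := hdot.1.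

Lemma dot_inj y z : (forall x, dot x y = dot x z) -> y = z.
Proof.
move=> E; apply/eqP; rewrite -subr_eq0; apply/eqP; apply: (dot_eq0 hdot).
by rewrite (formBr hf) E subrr.
Qed.

Lemma dot_closure x (M : set V) :
  (forall y, M y -> dot x y = 0) -> forall z, closure M z -> dot x z = 0.
Proof.
move=> xM z /closure_normP cz; apply/eqP; rewrite -normr_eq0; apply/eqP.
apply: (@ge0_approx0 _ `|x|) => // e /cz[y My ye].
have -> : dot x z = dot x (z - y) by rewrite (formBr hf) (xM _ My) subr0.
by rewrite (le_trans (cauchy_schwarz hs hdot _ _))// ler_wpM2l// ltW.
Qed.

Section Operator.
Variable T : V -> V.
Hypotheses (Tlin : linear T) (Tbnd : bounded_op T).

(** Riesz, applied to [fun x => dot y (T x)], shows that the choice made in [adjoint] is from a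
    nonempty set. *)
Lemma adjointP x y : dot (T x) y = dot x (adjoint dot T y).
Proof.
have [C C0 TC] := bounded_op_gt0 Tbnd.
have [||z zE] := @riesz _ _ hs _ _ hdot (fun x => dot y (T x)) (`|y| * C).
- by move=> a x' y'; rewrite Tlin (formPr hf).
- move=> x'; rewrite (le_trans (cauchy_schwarz hs hdot _ _))// -mulrA.
  by rewrite ler_wpM2l.
have ex : exists z, forall x, dot (T x) y = dot x z.
  by exists z => x'; rewrite (formC hf) zE -(formC hf).
exact: (@xgetPex _ 0 [set z | forall x, dot (T x) y = dot x z] ex).
Qed.

Lemma adjoint_linear : linear (adjoint dot T).
Proof.
move=> a y z; apply: dot_inj => x.
by rewrite -adjointP !(formPr hf) !adjointP.
Qed.

Lemma adjoint_bounded : bounded_op (adjoint dot T).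
Proof.
have [C C0 TC] := bounded_op_gt0 Tbnd; exists C => y.
have [->|A0] := eqVneq (adjoint dot T y) 0; first by rewrite normr0 mulr_ge0// ltW.
(* With a = [adjoint dot T y], the claim times |a| is |a|^2 = dot (T a) y <= C |a| |y|. *)
rewrite -(@ler_pM2r _ `|adjoint dot T y|) ?normr_gt0//.
rewrite -expr2 -(dotxx hdot) -adjointP.
have := cauchy_schwarz hs hdot (T (adjoint dot T y)) y.
rewrite adjointP (dotxx hdot) normrX normr_id => /le_trans; apply.
by rewrite mulrAC ler_wpM2r.
Qed.

Lemma adjoint_zpow : bijective T -> bijective (adjoint dot T) ->
  forall N x y, dot (zpow T N x) y = dot x (zpow (adjoint dot T) N y).
Proof.
move=> bT bA; elim/int_rec => // n IH x y.
  by rewrite -addn1 PoszD zpowS// adjointP IH zpowD.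
rewrite -addn1 PoszD opprD (zpowB1 bT).
by rewrite -[y in LHS](inv_opVK bA) -adjointP inv_opVK// IH zpowD.
Qed.

End Operator.

(** The adjoint of the inverse is a two-sided inverse of the adjoint. *)
Lemma adjoint_inverse (T : V -> V) :
  linear T -> bounded_op T -> bijective T -> bounded_op (inv_op T) ->
  bijective (adjoint dot T) /\
  inv_op (adjoint dot T) = adjoint dot (inv_op T).
Proof.
move=> Tlin Tb bT ib; have ilin := inv_op_linear Tlin bT.
have K1 : cancel (adjoint dot T) (adjoint dot (inv_op T)).
  by move=> y; apply: dot_inj => x; rewrite -!adjointP// inv_opVK.
have K2 : cancel (adjoint dot (inv_op T)) (adjoint dot T).
  by move=> y; apply: dot_inj => x; rewrite -!adjointP// inv_opK.
by split; [exists (adjoint dot (inv_op T))|exact: inv_op_eq].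
Qed.

End Adjoint.

Section OrthonormalBasis.
Context {K : numFieldType} {conj : K -> K} (hs : scalars conj).
Context {V : completeNormedModType K} {dot : V -> V -> K}.
Hypothesis hdot : inner_product conj dot.
Let hf : hermitian_form conj dot := hdot.1.
Context {b : int -> V} (hb : orthonormal_basis dot b).

Lemma basis_total x : (forall n, dot (b n) x = 0) -> x = 0.
Proof.
move=> x0; apply: (dot_eq0 hdot); apply: (dot_closure hs hdot (M := lspan (range b))).
  have Mlin : linear_subspace [set y | dot x y = 0].
    by split=> /= [|a y z y0 z0]; rewrite ?(form0r hf)// (formPr hf) y0 z0 mulr0 addr0.
  move=> y; apply: (lspan_sub Mlin) => _ [n _ <-] /=.
  by rewrite (formC hf) x0 (conj0 hs).
by rewrite hb.2.
Qed.

Lemma norm_basis n : `|b n| = 1.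
Proof.
apply/eqP; rewrite -(@eqrXn2 _ 2)// -(dotxx hdot) hb.1 eqxx expr1n//.
Qed.

Lemma dot_basis_sum (s : seq int) (c : int -> K) j : uniq s ->
  dot (b j) (\sum_(k <- s) c k *: b k) = if j \in s then c j else 0.
Proof.
move=> us; rewrite (form_sumr hf).
rewrite (eq_bigr (fun k => if k == j then c j else 0)); last first.
  move=> k _; rewrite (formZr hf) hb.1 eq_sym.
  by case: eqVneq => [->|_]; rewrite ?mulr1// mulr0.
case: ifPn => js; last first.
  by rewrite big_seq big1// => k ks; case: eqVneq => // kj; rewrite -kj ks in js.
by rewrite (bigD1_seq j)//= eqxx big1 ?addr0// => k /negPf ->.
Qed.

Lemma dot_sum_basis (s : seq int) (c : int -> K) x :
  dot (\sum_(k <- s) c k *: b k) x = \sum_(k <- s) conj (c k) * dot (b k) x.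
Proof.
by rewrite (form_suml hs hf); apply: eq_bigr => k _; rewrite (formZl hs hf).
Qed.

(** Over a given list the Fourier sum is the best approximation: x minus it is orthogonal to all
    combinations over that list. Allowing every larger list lets two vectors share one. *)
Lemma fourier_approx x (e : K) : 0 < e -> exists s0 : seq int,
  forall s, uniq s -> {subset s0 <= s} ->
  `|x - \sum_(k <- s) dot (b k) x *: b k| < e.
Proof.
move=> e0; have /closure_normP cx : closure (lspan (range b)) x by rewrite hb.2.
have [y /lspan_rangeP[s0 H] xe] := cx e e0.
exists s0 => s us ss; have [c E] := H s us ss.
apply: le_lt_trans xe; rewrite {}E.
set p := \sum_(k <- s) dot (b k) x *: b k.
have -> : x - \sum_(k <- s) c k *: b k = (x - p) + \sum_(k <- s) (dot (b k) x - c k) *: b k.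
  under [in RHS]eq_bigr do rewrite scalerBl.
  by rewrite sumrB addrA subrK.
rewrite -(@ler_pXn2r _ 2)// ?nnegrE// [leRHS](pythagoras hs hdot).
  by rewrite lerDl exprn_ge0.
rewrite (formC hf) dot_sum_basis big_seq big1 ?(conj0 hs)// => k ks.
by rewrite (formBr hf) dot_basis_sum// ks subrr mulr0.
Qed.

End OrthonormalBasis.

(** * Weighted shifts *)

Section WeightedShift.
Context {K : numFieldType} {conj : K -> K} (hs : scalars conj).
Context {H : completeNormedModType K} {dot : H -> H -> K}.
Hypothesis hdot : inner_product conj dot.
Let hf : hermitian_form conj dot := hdot.1.
Context {b : int -> H} (hb : orthonormal_basis dot b).
Context {u : int -> K} (hu0 : forall n, u n != 0).
Hypothesis hu_conj : forall n, conj (u (- n)) = u n.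
Context {U : {linear H -> H}} (hU : is_weighted_shift u b U).
Let Ulin : linear U := linearP U.
Let Ubnd : bounded_op U := hU.1.
Let Ub : forall n, U (b n) = (u (n + 1) / u n) *: b (n + 1) := hU.2.
Local Notation A := (adjoint dot U).

Lemma norm_weightN n : `|u (- n)| = `|u n|.
Proof. by rewrite -(norm_conj hs) hu_conj. Qed.

(* The symmetry of the weights makes the ratios at n and -n-1 reciprocal, so
   an upper bound for the ratios is also a lower bound. *)
Lemma shift_bounded_below : exists2 C, 0 < C & forall x, `|x| <= C * `|U x|.
Proof.
have [M M0 UM] := bounded_op_gt0 Ubnd; exists M => //.
have rM n : `|u (n + 1) / u n| <= M.
  by have := UM (b n); rewrite Ub normrZ !(norm_basis hdot hb) !mulr1.
have Mr n : 1 <= M * `|u (n + 1) / u n|.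
  have := rM (- (n + 1)); rewrite opprD subrK -opprD.
  rewrite !normrM !normfV !norm_weightN => rn.
  rewrite -ler_pdivrMr ?divr_gt0 ?normr_gt0//.
  by rewrite invf_div mul1r.
(* Parseval for finite sums, used for [b] and for [b] shifted by one. *)
have norm2_sum (v : int -> H) s (c : int -> K) : uniq s ->
    (forall m n, dot (v m) (v n) = (m == n)%:R) ->
    `|\sum_(k <- s) c k *: v k| ^+ 2 = \sum_(k <- s) `|c k| ^+ 2.
  move=> us vo; rewrite -(dotxx hdot) (form_suml hs hf).
  rewrite big_seq [RHS]big_seq; apply: eq_bigr => j js.
  rewrite (form_sumr hf) (bigD1_seq j)//= big1 ?addr0.
    by rewrite (formZl hs hf) (formZr hf) vo eqxx mulr1 (conj_norm hs).
  move=> k kj; rewrite (formZl hs hf) (formZr hf) vo eq_sym (negPf kj).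
  by rewrite !mulr0.
have span_below x : lspan (range b) x -> `|x| <= M * `|U x|.
  move=> /lspan_rangeP[s0 /(_ _ (undup_uniq s0))[|c ->]].
    by move=> k; rewrite mem_undup.
  set s := undup s0; have us : uniq s by exact: undup_uniq.
  rewrite -(@ler_pXn2r _ 2)// ?nnegrE ?mulr_ge0 ?(ltW M0)// exprMn.
  have -> : U (\sum_(k <- s) c k *: b k) =
      \sum_(k <- s) (c k * (u (k + 1) / u k)) *: b (k + 1).
    by rewrite linear_sum; apply: eq_bigr => k _; rewrite linearZZ Ub scalerA.
  rewrite (norm2_sum b)//; last by move=> m n; rewrite hb.1.
  rewrite (norm2_sum (fun k => b (k + 1)))//; last first.
    by move=> m n; rewrite hb.1 (inj_eq (addIr _)).
  rewrite mulr_sumr; apply: ler_sum => k _.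
  rewrite -exprMn ler_pXn2r// ?nnegrE ?mulr_ge0// ?(ltW M0)//.
  by rewrite normrM mulrCA ler_peMr.
(* For y in the span within e of x, |x| <= e + M |U y| <= e + M (|U x| + M e), whence the constant 1
   + M * M. *)
move=> x; apply: (@le_approx _ (1 + M * M)); rewrite ?realM ?ger0_real ?(ltW M0)//.
  by rewrite addr_ge0// mulr_ge0// ltW.
move=> e e0; have /closure_normP cx : closure (lspan (range b)) x by rewrite hb.2.
have [y My xy] := cx e e0; rewrite -[x in leLHS](subrK y) (le_trans (ler_normD _ _))//.
rewrite mulrDl mul1r addrCA lerD ?(ltW xy)//.
rewrite (le_trans (span_below _ My))// -mulrA -mulrDr ler_wpM2l ?(ltW M0)//.
have -> : U y = U x - U (x - y) by rewrite linearB opprB addrC subrK.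
rewrite (le_trans (ler_normB _ _))// lerD2l (le_trans (UM _))//.
by rewrite ler_wpM2l ?(ltW M0)// ltW.
Qed.

Lemma shift_coef n x :
  dot (b (n + 1)) (U x) = u (n + 1) / u n * dot (b n) x.
Proof.
have E : A (b (n + 1)) = conj (u (n + 1) / u n) *: b n.
  apply/eqP; rewrite -subr_eq0; apply/eqP; apply: (basis_total hs hdot hb) => m.
  rewrite (formBr hf) -(adjointP hs hdot Ulin Ubnd) Ub (formZl hs hf) (formZr hf).
  rewrite !hb.1 (inj_eq (addIr _)); case: eqVneq => [->|_]; first by rewrite subrr.
  by rewrite !mulr0 subrr.
rewrite (formC hf) (adjointP hs hdot Ulin Ubnd) E (formZr hf).
by rewrite (conjM hs (conj _)) (conjK hs) -(formC hf).
Qed.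

(** The lower bound gives injectivity and, with density of the range, surjectivity; the range is
    dense because it contains nonzero multiples of all basis vectors. *)
Lemma shift_bijective : bijective U.
Proof.
have [C C0 UC] := shift_bounded_below.
have dense : closure (range U) = [set: H].
  apply: (orth_dense hs hdot).
    split; first by exists 0; rewrite ?linear0.
    by move=> a _ _ [x _ <-] [y _ <-]; exists (a *: x + y); rewrite ?linearP.
  move=> q qU; apply: (basis_total hs hdot hb) => n.
  have := qU _ (ex_intro2 _ _ (b (n - 1)) I erefl).
  rewrite Ub subrK (formZl hs hf) => /eqP; rewrite mulf_eq0 (conj_eq0 hs).
  by rewrite mulf_eq0 invr_eq0 !(negPf (hu0 _)) => /eqP.
have surj := bounded_below_surjective Ulin Ubnd C0 UC dense.
have UK y : U (sval (cid (surj y))) = y by exact: svalP (cid (surj y)).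
exists (fun y => sval (cid (surj y))) => // x.
apply/eqP; rewrite -subr_eq0 -normr_eq0; apply/eqP.
by apply/le_anti; rewrite normr_ge0 andbT (le_trans (UC _))// linearB UK subrr normr0 mulr0.
Qed.

Lemma inv_shift_bounded : bounded_op (inv_op U).
Proof.
have [C C0 UC] := shift_bounded_below; exists C => y.
by rewrite (le_trans (UC _))// (inv_opVK shift_bijective).
Qed.

Lemma adjoint_shift_bijective : bijective A.
Proof.
by have [] := adjoint_inverse hs hdot Ulin Ubnd shift_bijective inv_shift_bounded.
Qed.

Lemma inv_adjointE : inv_op A = adjoint dot (inv_op U).
Proof.
by have [] := adjoint_inverse hs hdot Ulin Ubnd shift_bijective inv_shift_bounded.
Qed.

Let iUlin : linear (inv_op U) := inv_op_linear Ulin shift_bijective.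

Lemma inv_adjointP x y : dot (inv_op U x) y = dot x (inv_op A y).
Proof.
by rewrite inv_adjointE (adjointP hs hdot iUlin inv_shift_bounded).
Qed.

Lemma inv_adjoint_coef n y :
  dot (b (n + 1)) (inv_op A y) = conj (u n / u (n + 1)) * dot (b n) y.
Proof.
rewrite -inv_adjointP; have -> : b (n + 1) = U ((u n / u (n + 1)) *: b n).
  rewrite linearZZ Ub scalerA mulrA divfK ?hu0// divff ?hu0// scale1r//.
by rewrite (inv_opK shift_bijective) (formZl hs hf).
Qed.

Lemma zpow_shift N : zpow U N (b 0) = (u N / u 0) *: b N.
Proof.
have bU := shift_bijective.
elim/int_rec: N => [|n IH|n IH]; first by rewrite /= divff ?hu0// scale1r.
  rewrite -addn1 PoszD zpowS// IH linearZZ Ub scalerA.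
  by congr (_ *: _); field; rewrite !hu0.
rewrite -addn1 PoszD opprD zpowB1// IH; apply: (bij_inj bU); rewrite inv_opVK//.
by rewrite linearZZ Ub subrK scalerA; congr (_ *: _); field; rewrite !hu0.
Qed.

(** The inverse of the adjoint contributes the exponent -N, so the orbit of (g, h) under this
    operator is the generating family of [shift_span dot U g h]. *)
Lemma zpow_dual N p :
  zpow (fun p : H * H => (U p.1, inv_op A p.2)) N p =
  (zpow U N p.1, zpow A (- N) p.2).
Proof.
have [_ _ ->] := zpow_prod shift_bijective (bij_inv_op adjoint_shift_bijective).
by rewrite (zpow_inv adjoint_shift_bijective).
Qed.

Lemma swap_form_hermitian : hermitian_form conj (swap_form dot).
Proof.
split=> [p _ a q r _ _|p q _ _]; rewrite /swap_form/=.
  by rewrite !(formPr hf) addrACA -mulrDr.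
by rewrite (conjD hs) -!(formC hf) addrC.
Qed.

(** Moved to the other side of [dot], [inv_op A] becomes [inv_op U] and cancels [U]. *)
Lemma dual_unitary :
  form_unitary (swap_form dot) (fun p : H * H => (U p.1, inv_op A p.2)).
Proof.
have bU := shift_bijective; have bA := adjoint_shift_bijective.
have [bV iV _] := zpow_prod bU (bij_inv_op bA).
have unit p q : swap_form dot (U p.1, inv_op A p.2) (U q.1, inv_op A q.2) =
    swap_form dot p q.
  rewrite /swap_form/= -inv_adjointP (formC hf (U q.1)) -inv_adjointP.
  by rewrite !(inv_opK bU) -(formC hf).
split=> // p q; rewrite -unit iV/=.
by rewrite !(inv_opVK bU) !(inv_opVK (bij_inv_op bA)); case: p q => ? ? [].
Qed.

End WeightedShift.

(** * Graphs of diagonal operators *)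

(* With w n = |u_n|^2 this is the graph of [sg * D], where D is the closed,
   possibly unbounded, operator with D b_n = |u_n|^-2 b_n. *)
Definition weight_graph (K : numFieldType) (H : lmodType K) (dot : H -> H -> K)
    (b : int -> H) (w : int -> K) (sg : K) : set (H * H) :=
  [set p | forall n, sg * dot (b n) p.1 = w n * dot (b n) p.2].

Section WeightGraph.
Context {K : numFieldType} {conj : K -> K} (hs : scalars conj).
Context {H : completeNormedModType K} {dot : H -> H -> K}.
Hypothesis hdot : inner_product conj dot.
Let hf : hermitian_form conj dot := hdot.1.
Context {b : int -> H} (hb : orthonormal_basis dot b).
Context {w : int -> K} (w_gt0 : forall n, 0 < w n).
Local Notation E := (l2prod (sqrts hs) H H).
Local Notation dotE := (fun p q : E => dot p.1 q.1 + dot p.2 q.2).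
Local Notation form := (swap_form dot : E -> E -> K).
Local Notation L sg := (weight_graph dot b w sg : set E).

Let hdotE : inner_product conj dotE := l2prod_inner (sqrts hs) hs hdot hdot.
Let wE n : conj (w n) = w n. Proof. by rewrite (conj_nneg hs)// ltW. Qed.
Let w0 n : w n != 0. Proof. by rewrite gt_eqF. Qed.

Lemma conj_sqr1 sg : sg ^+ 2 = 1 -> conj sg = sg.
Proof.
by move=> /eqP; rewrite sqrf_eq1 => /orP[] /eqP ->; rewrite ?(conjN hs) (conj1 hs).
Qed.

Lemma weight_graph_linear sg : linear_subspace (L sg).
Proof.
split=> [n|a p q Lp Lq n] /=; first by rewrite (form0r hf) !mulr0.
by rewrite !(formPr hf) !mulrDr mulrCA Lp Lq mulrCA.
Qed.

(** This presents the graph as a Hilbert orthocomplement, hence as a closed set. *)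
Lemma weight_graph_orth sg p : conj sg = sg ->
  L sg p <-> forall n, dotE (sg *: b n, - w n *: b n) p = 0.
Proof.
move=> sE; split=> Lp n; have := Lp n; rewrite /= !(formZl hs hf) (conjN hs) wE sE.
  by move=> ->; rewrite mulNr subrr.
by rewrite mulNr => /eqP; rewrite subr_eq0 => /eqP.
Qed.

Lemma weight_graph_closure sg : sg ^+ 2 = 1 -> closure (L sg) `<=` L sg.
Proof.
move=> s1 p cp; apply/(weight_graph_orth _ (conj_sqr1 s1)) => n.
apply: (dot_closure hs hdotE (M := L sg)) cp => q.
by move=> /(weight_graph_orth _ (conj_sqr1 s1)).
Qed.

Lemma weight_graph_closed sg : sg ^+ 2 = 1 -> closed (L sg).
Proof.
move=> s1; apply/closure_id/seteqP; split; first exact: subset_closure.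
exact: weight_graph_closure.
Qed.

(** Formally sg * dot x y is the sum of the w k |y k|^2. Truncating y to finitely many coordinates,
    one of them nonzero, leaves an error smaller than a single positive term c. *)
Lemma weight_graph_sign sg p : sg ^+ 2 = 1 -> L sg p -> p != 0 ->
  0 < sg * form p p.
Proof.
move=> s1 Lp p0; case: p => x y in Lp p0 *.
have sE := conj_sqr1 s1.
have [m ym] : exists m, dot (b m) y != 0.
  apply: contrapT => ally; case/eqP: p0.
  have y0 : y = 0.
    apply: (basis_total hs hdot hb) => n.
    by have [//|yn] := eqVneq (dot (b n) y) 0; case: ally; exists n.
  suff x0 : x = 0 by rewrite x0 y0.
  apply: (basis_total hs hdot hb) => n; have := Lp n.
  rewrite /= y0 (form0r hf) mulr0 => /(congr1 ( *%R sg)).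
  by rewrite mulrA -expr2 s1 mul1r mulr0.
pose c := w m * `|dot (b m) y| ^+ 2.
have c0 : 0 < c by rewrite mulr_gt0// exprn_gt0// normr_gt0.
have x1 : 0 < `|x| + 1 by rewrite ltr_wpDl.
(* By Cauchy-Schwarz this tolerance keeps the error [r] below c; the summand 1 covers x = 0. *)
have [s0 near_y] := fourier_approx hs hdot hb y (divr_gt0 c0 x1).
pose s := undup (m :: s0); have us : uniq s by exact: undup_uniq.
have s0s : {subset s0 <= s} by move=> k ks; rewrite mem_undup inE ks orbT.
have := near_y s us s0s; set P := \sum_(k <- s) _ => yP.
pose S := \sum_(k <- s) w k * `|dot (b k) y| ^+ 2.
have SP : dot x P = sg * S.
  rewrite (form_sumr hf) mulr_sumr; apply: eq_bigr => k _.
  have xk : dot (b k) x = sg * (w k * dot (b k) y).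
    by rewrite -Lp /= mulrA -expr2 s1 mul1r.
  rewrite (formZr hf) (formC hf (b k) x) xk !(conjM hs) sE wE -(conj_norm hs).
  by ring.
have cS : c <= S.
  rewrite /S (bigD1_seq m)//=; last by rewrite mem_undup mem_head.
  by rewrite lerDl sumr_ge0// => k _; rewrite mulr_ge0 ?exprn_ge0// ltW.
pose r := sg * dot x (y - P).
have xyE : sg * dot x y = r + S.
  rewrite -[y in LHS](subrK P) (formDr hf) mulrDr SP mulrA -expr2 s1 mul1r.
  by [].
have n1 : `|sg| = 1.
  by apply/eqP; rewrite -(@eqrXn2 _ 2)// expr1n -normrX s1 normr1.
have rc : `|r| < c.
  rewrite normrM n1 mul1r (le_lt_trans (cauchy_schwarz hs hdot _ _))//.
  move: yP; rewrite ltr_pdivlMr// mulrC => /(le_lt_trans _); apply.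
  by rewrite ler_wpM2r// lerDl.
have SE : conj S = S.
  by rewrite (conj_nneg hs)// (le_trans _ cS)// ltW.
(* The form is twice the real part of S + r; the sign is arranged so that [add_conj_le] applies to -
   r. *)
have -> : sg * form (x, y) (x, y) = 2 * S - (- r + conj (- r)).
  rewrite /swap_form/= mulrDr (formC hf x y) -{2}sE -(conjM hs) xyE.
  by rewrite (conjD hs) (conjN hs) SE; ring.
rewrite subr_gt0 (le_lt_trans (add_conj_le hs _))// normrN ltr_pM2l//.
exact: lt_le_trans cS.
Qed.

(** The k-th coordinates of x and x' are sg w k y k and - sg w k y' k, so the two products cancel
    term by term in Fourier sums over a common list. *)
Lemma weight_graph_orthogonal sg p q : sg ^+ 2 = 1 -> L sg p -> L (- sg) q ->
  form p q = 0.
Proof.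
move=> s1; have sE := conj_sqr1 s1; case: p q => [x y] [x' y'] Lp Lq.
apply/eqP; rewrite -normr_eq0; apply/eqP.
apply: (@ge0_approx0 _ (`|x| + `|y|)) => [||e e0]; rewrite ?addr_ge0//.
have [s1' H1] := fourier_approx hs hdot hb y' e0.
have [s2' H2] := fourier_approx hs hdot hb x' e0.
pose s := undup (s1' ++ s2'); have us : uniq s by exact: undup_uniq.
have {}H1 : `|y' - \sum_(k <- s) dot (b k) y' *: b k| < e.
  by apply: H1 => // k ks; rewrite mem_undup mem_cat ks.
have {}H2 : `|x' - \sum_(k <- s) dot (b k) x' *: b k| < e.
  by apply: H2 => // k ks; rewrite mem_undup mem_cat ks orbT.
set P1 := \sum_(k <- s) _ in H1; set P2 := \sum_(k <- s) _ in H2.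
have P0 : dot x P1 + dot y P2 = 0.
  rewrite !(form_sumr hf) -big_split big1//= => k _.
  rewrite !(formZr hf) (formC hf (b k) x) (formC hf (b k) y).
  have xk : dot (b k) x = sg * (w k * dot (b k) y).
    by rewrite -Lp /= mulrA -expr2 s1 mul1r.
  have xk' : dot (b k) x' = - (sg * (w k * dot (b k) y')).
    by rewrite -Lq /= mulNr mulrN opprK mulrA -expr2 s1 mul1r.
  by rewrite xk xk' !(conjM hs) sE wE; ring.
have -> : form (x, y) (x', y') = dot x (y' - P1) + dot y (x' - P2).
  by rewrite !(formBr hf) addrACA -opprD P0 subr0.
rewrite (le_trans (ler_normD _ _))// mulrDl lerD//.
  by rewrite (le_trans (cauchy_schwarz hs hdot _ _))// ler_wpM2l// ltW.
by rewrite (le_trans (cauchy_schwarz hs hdot _ _))// ler_wpM2l// ltW.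
Qed.

(* The Hilbert orthocomplement of the graph for sg is the image of the graph
   for -sg under the swap of the two coordinates. *)
Lemma weight_graph_ortho_swap sg q : conj sg = sg ->
  (forall p, L sg p -> dotE p q = 0) -> L (- sg) (q.2, q.1).
Proof.
(* The test vector is the point of the graph above w n b n. *)
move=> sE Lq n /=; have Lt : L sg (w n *: b n, sg *: b n).
  move=> k /=; rewrite !(formZr hf) hb.1.
  by case: eqVneq => [->|_]; [ring|rewrite !mulr0].
have := Lq _ Lt; rewrite /= !(formZl hs hf) wE sE => /eqP.
by rewrite mulNr addr_eq0 => /eqP ->.
Qed.

(** Project p in [M] on the graph. The remainder is in [M], and its swap is in the graph for - sg,
    where the form has strictly the wrong sign unless the remainder vanishes. *)
Lemma weight_graph_maximal sg (M : set E) : sg ^+ 2 = 1 ->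
  linear_subspace M -> (forall p, M p -> 0 <= sg * form p p) ->
  L sg `<=` M -> M `<=` L sg.
Proof.
move=> s1 Mlin M0 LM p Mp; have sE := conj_sqr1 s1.
have [m cm orth] := projection hs hdotE p (weight_graph_linear sg).
have Lm := weight_graph_closure s1 cm.
suff /eqP : p - m = 0 by rewrite subr_eq0 => /eqP ->.
have Mq : M (p - m) by apply: (subspaceB Mlin) => //; exact: LM.
have := weight_graph_ortho_swap sE orth; move: (p - m) Mq => q Mq Lq.
apply/eqP/negP => /negP q0; have := M0 _ Mq; apply/negP.
have sN1 : (- sg) ^+ 2 = 1 by rewrite sqrrN.
have q0' : ((q.2, q.1) : E) != 0.
  by apply: contra q0 => /eqP[q2 q1]; case: q q1 q2 {Mq Lq} => ? ? /= -> ->.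
have := weight_graph_sign sN1 Lq q0'.
rewrite mulNr oppr_gt0 /swap_form/= addrC => /lt_geF -> //.
Qed.

Lemma weight_graph_dense sg : sg ^+ 2 = 1 ->
  closure (sum_set (L sg) (L (- sg))) = [set: E].
Proof.
move=> s1; have sE := conj_sqr1 s1.
have s0 : sg != 0 by rewrite -sqrf_eq0 s1 oner_eq0.
have [L1 L2] := (weight_graph_linear sg, weight_graph_linear (- sg)).
apply: (orth_dense hs hdotE).
  split; first by exists 0; [exact: subspace0 L1|exists 0; [exact: subspace0 L2|rewrite addr0]].
  move=> a _ _ [p Lp [q Lq <-]] [p' Lp' [q' Lq' <-]].
  exists (a *: p + p'); first exact: L1.2.
  by exists (a *: q + q'); [exact: L2.2|rewrite scalerDr addrACA].
move=> q orth.
have q1 : L (- sg) (q.2, q.1).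
  apply: weight_graph_ortho_swap => // p Lp; apply: orth.
  by exists p => //; exists 0; rewrite ?addr0//; exact: subspace0 L2.
have q2 : L (- - sg) (q.2, q.1).
  apply: weight_graph_ortho_swap; first by rewrite (conjN hs) sE.
  move=> p Lp; apply: orth.
  by exists 0; [exact: subspace0 L1|exists p; rewrite ?add0r].
(* The swap of q lies in both graphs; adding the two coordinate equations isolates q.1. *)
have d0 n : dot (b n) q.2 = 0 /\ dot (b n) q.1 = 0.
  have := q2 n; have := q1 n => /=; rewrite opprK mulNr => E1 E2.
  have /eqP : 2 * (w n * dot (b n) q.1) = 0.
    by rewrite mulr_natl mulr2n -{1}E1 -E2 addNr.
  rewrite !mulf_eq0 pnatr_eq0 (negPf (w0 n))/= => /eqP d1; split=> //.
  by move: E2; rewrite d1 mulr0 => /eqP; rewrite mulf_eq0 (negPf s0) => /eqP.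
have qE1 : q.1 = 0 by apply: (basis_total hs hdot hb) => n; case: (d0 n).
have qE2 : q.2 = 0 by apply: (basis_total hs hdot hb) => n; case: (d0 n).
by case: q qE1 qE2 {orth q1 q2 d0} => ? ? /= -> ->.
Qed.

End WeightGraph.

(** * The completion and the invariant subspaces *)

Section SpanMaps.
Context {K : numFieldType}.

Lemma linear_on0 (V W : lmodType K) (D : set V) (phi : V -> W) :
  linear_subspace D -> linear_on D phi -> phi 0 = 0.
Proof.
move=> Dlin philin; have D0 := subspace0 Dlin.
by apply: (@addrI _ (phi 0)); have := philin 1 0 0 D0 D0; rewrite !scale1r !addr0.
Qed.

Lemma linear_on_lspan_eq (V W : lmodType K) (S : set V) (phi psi : V -> W) :
  linear_on (lspan S) phi -> linear_on (lspan S) psi ->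
  (forall x, S x -> phi x = psi x) -> forall x, lspan S x -> phi x = psi x.
Proof.
move=> philin psilin E x Sx; have Slin := lspan_linear S.
(* The maps are linear only on the span, so the set of agreement is a subspace only inside it. *)
suff [] : (lspan S `&` [set x | phi x = psi x]) x by [].
apply: (lspan_sub _ _ Sx); last by move=> y Sy; split; [exact: sub_lspan|exact: E].
split; first by split; [exact: subspace0 Slin|rewrite /= !(linear_on0 Slin)].
move=> a y z [Sy Ey] [Sz Ez]; split; first exact: Slin.2.
by rewrite /= philin// psilin// Ey Ez.
Qed.

Lemma orbit_span_invariant (V : lmodType K) (T : {linear V -> V}) (x y : V) :
  bijective T -> orbit_span T x y ->
  orbit_span T x (T y) /\ orbit_span T x (inv_op T y).
Proof.
move=> bT xy; have Slin : linear_subspace (orbit_span T x) := lspan_linear _.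
have iTlin := inv_op_linear (linearP T) bT.
split; move: y xy.
  apply: (lspan_sub (M := [set y | orbit_span T x (T y)])).
    split=> [|a y z Ty Tz] /=; first by rewrite linear0; exact: subspace0 Slin.
    by rewrite linearP; exact: Slin.2.
  by move=> _ [N _ <-]; apply: sub_lspan; exists (N + 1) => //; rewrite zpowS.
apply: (lspan_sub (M := [set y | orbit_span T x (inv_op T y)])).
  split=> [|a y z Ty Tz] /=; last by rewrite iTlin; exact: Slin.2.
  by rewrite -(linear0 T) inv_opK//; exact: subspace0 Slin.
by move=> _ [N _ <-]; apply: sub_lspan; exists (N - 1) => //; rewrite zpowB1.
Qed.

End SpanMaps.

Section FormMaps.
Context {K : numFieldType} {conj : K -> K} (hs : scalars conj).

(** Two maps and a factor c are allowed so as to compare the images of one orbit under the two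
    halves of the embedding. *)
Lemma form_lspan_eq (V W : lmodType K) (g : V -> V -> K) (f : W -> W -> K)
    (S : set V) (phi psi : V -> W) (c : K) :
  hermitian_form conj g -> hermitian_form conj f ->
  linear_on (lspan S) phi -> linear_on (lspan S) psi ->
  (forall x y, S x -> S y -> f (phi x) (psi y) = c * g x y) ->
  forall x y, lspan S x -> lspan S y -> f (phi x) (psi y) = c * g x y.
Proof.
move=> hg hf philin psilin E; have Slin := lspan_linear S.
have E1 x y : S x -> lspan S y -> f (phi x) (psi y) = c * g x y.
  move=> Sx Sy; apply: (@linear_on_lspan_eq K V K^o S (fun y => f (phi x) (psi y))
    (fun y => c * g x y)) Sy => [a y1 y2 S1 S2|a y1 y2 S1 S2|z Sz]; last exact: E.
    by rewrite psilin// (formPr hf).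
  by rewrite (formPr hg) mulrDr mulrCA.
(* Hermitian symmetry moves the first argument to the linear side. *)
move=> x y Sx Sy; apply/(can_inj (conjK hs)); rewrite (conjM hs) -(formC hf) -(formC hg).
apply: (@linear_on_lspan_eq K V K^o S (fun x => f (psi y) (phi x))
    (fun x => conj c * g y x)) Sx => [a y1 y2 S1 S2|a y1 y2 S1 S2|z Sz].
- by rewrite philin// (formPr hf).
- by rewrite (formPr hg) mulrDr mulrCA.
- by rewrite (formC hf) E1// (conjM hs) -(formC hg).
Qed.

Lemma bounded_form_continuous (V : normedModType K) (f : V -> V -> K) (C : K) :
  hermitian_form conj f -> 0 <= C -> (forall x y, `|f x y| <= C * (`|x| * `|y|)) ->
  forall (x y : V) (e : K), 0 < e -> exists2 d : K, 0 < d &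
  forall x' y', `|x' - x| < d -> `|y' - y| < d -> `|f x' y' - f x y| < e.
Proof.
move=> hf C0 fC x y e e0; pose B := C * (1 + `|x| + `|y|).
have B0 : 0 <= B by rewrite mulr_ge0// !addr_ge0.
have eB : 0 < e + B by rewrite ltr_pwDl.
(* Then d <= 1 and d * B < e, while the three terms of the expansion below are together at most C (d
   + |x| d + d |y|) = d * B. *)
pose d := e / (e + B); have d0 : 0 < d by rewrite divr_gt0.
have d1 : d <= 1 by rewrite ler_pdivrMr// mul1r lerDl.
exists d => // x' y' xd yd.
have -> : f x' y' - f x y =
    f (x' - x) (y' - y) + f x (y' - y) + f (x' - x) y.
  by rewrite !(formBl hs hf) !(formBr hf); ring.
have dB : d * B < e.
  by rewrite mulrAC ltr_pdivrMr// ltr_pM2l// ltrDr.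
apply: le_lt_trans dB; rewrite /B mulrCA [d * _]mulrDr [d * (1 + _)]mulrDr mulr1 !mulrDr.
have bound u v r s : `|u| <= r -> `|v| <= s -> `|f u v| <= C * (r * s).
  by move=> ur vs; rewrite (le_trans (fC _ _))// ler_wpM2l// ler_pM.
rewrite (le_trans (ler_normD _ _))// lerD//; last by rewrite bound// ltW.
rewrite (le_trans (ler_normD _ _))// lerD//; last by rewrite [d * _]mulrC bound// ltW.
rewrite (le_trans (bound _ _ d d (ltW xd) (ltW yd)))// ler_wpM2l//.
by rewrite ler_piMr// ltW.
Qed.

Lemma bounded_linear_continuous (V : normedModType K) (T : {linear V -> V}) :
  bounded_op T -> continuous T.
Proof.
move=> /bounded_op_gt0[M M0 TM] x; apply/cvgrPdist_lt => e e0.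
near=> y; rewrite -linearB (le_lt_trans (TM _))// mulrC -ltr_pdivlMr//.
by near: y; apply: cvgr_dist_lt => //; rewrite divr_gt0.
Unshelve. all: by end_near. Qed.

Lemma swap_form_bound (H : normedModType K) (dot : H -> H -> K) :
  inner_product conj dot -> forall p q : l2prod (sqrts hs) H H,
  `|swap_form dot p q| <= 2 * (`|p| * `|q|).
Proof.
move=> hdot p q; rewrite mulr_natl mulr2n (le_trans (ler_normD _ _))//.
have := (norm_fst_le p, norm_snd_le p, norm_fst_le q, norm_snd_le q).
move=> [[[p1 p2] q1] q2].
by apply: lerD; rewrite (le_trans (cauchy_schwarz hs hdot _ _))// ler_pM.
Qed.

End FormMaps.

Section OrbitForm.
Context {K : numFieldType} {conj : K -> K} (hs : scalars conj).
Context {V : lmodType K} {f : V -> V -> K} (hf : hermitian_form conj f).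
Context {T : {linear V -> V}} (hT : form_unitary f T).
Hypothesis neutral0 : forall M : set V, linear_subspace M -> op_invariant T M ->
  neutral f M -> M = [set 0].

(* The radical of f on the orbit span is invariant and neutral. *)
Lemma orbit_span_nondegenerate x y : orbit_span T x y ->
  (forall z, orbit_span T x z -> f y z = 0) -> y = 0.
Proof.
have [bT TT _] := hT; have Slin : linear_subspace (orbit_span T x) := lspan_linear _.
pose M := [set y | orbit_span T x y /\ forall z, orbit_span T x z -> f y z = 0].
move=> Sy y0; suff M0 : M = [set 0] by have : M y by []; rewrite M0.
apply: neutral0 => [||z [Sz z0]]; last exact: z0.
- split=> [|a y1 y2 [S1 M1] [S2 M2]].
    by split=> [|z _]; [exact: subspace0 Slin|rewrite (form0l hs hf)].
  split=> [|z Sz]; first exact: Slin.2.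
  by rewrite (formDl hs hf) (formZl hs hf) M1// M2// mulr0 addr0.
- move=> _ [z [Sz z0] <-]; split; first by have [] := orbit_span_invariant bT Sz.
  move=> t /(orbit_span_invariant bT)[_ St].
  (* Write t as T applied to its preimage, which stays in the orbit span, and cancel T on both
     sides. *)
  by rewrite -(inv_opVK bT t) TT z0.
Qed.

End OrbitForm.

Theorem theorem4p1
  (K : numFieldType) (conj : K -> K) (hK : real_or_complex conj)
  (* H_0, its indefinite inner product, and U_0 *)
  (H0 : completeNormedModType K) (dot0 : H0 -> H0 -> K)
  (hdot0 : inner_product conj dot0)
  (form0 : H0 -> H0 -> K) (hform0 : hermitian_form conj form0)
  (U0 : {linear H0 -> H0}) (hU0 : form_unitary form0 U0)
  (hU0_bounded : bounded_op U0)
  (hU0_neutral : forall M : set H0, linear_subspace M -> op_invariant U0 M ->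
     neutral form0 M -> M = [set 0])
  (x0 : H0)
  (hx0_indep : lin_indep_family (fun N : int => zpow U0 N x0))
  (hx0_cyclic : closure (orbit_span U0 x0) = [set: H0])
  (* H, the weights, the weighted shift U, and f_0 *)
  (H : completeNormedModType K) (dot : H -> H -> K)
  (hdot : inner_product conj dot)
  (b : int -> H) (hb : orthonormal_basis dot b)
  (u : int -> K) (hu_neq0 : forall n, u n != 0)
  (hu_conj : forall n, conj (u (- n)) = u n)
  (hu_l2 : square_summable
     (fun N : int => (u N)^-1 * form0 x0 (zpow U0 N x0)))
  (U : {linear H -> H}) (hU : is_weighted_shift u b U)
  (f0 : H)
  (hf0 : forall N : int, dot (b N) f0 =
     2^-1 * (conj (u 0) / conj (u N)) * conj (form0 x0 (zpow U0 N x0)))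
  (hA : property_A dot U (b 0) f0) :
  let D : set (H0 * H0) := orbit_span U0 x0 `*` orbit_span U0 x0 in
  exists nrm : H0 * H0 -> K,
  [/\ prehilbert_norm_on conj D nrm,
      form_continuous_on D nrm (minus_form form0),
      op_continuous_on D nrm (oplus_op U0) &
  exists (Hext : completeNormedModType K) (dot_ext : Hext -> Hext -> K)
    (iota : H0 * H0 -> Hext)
    (form_ext : Hext -> Hext -> K) (Uext : {linear Hext -> Hext}),
  [/\ inner_product conj dot_ext /\ is_completion D nrm iota,
      [/\ hermitian_form conj form_ext,
          continuous (fun p : Hext * Hext => form_ext p.1 p.2) &
          forall x y, D x -> D y ->
            form_ext (iota x) (iota y) = minus_form form0 x y],
      [/\ bijective Uext,
          continuous Uext &
          forall x, D x -> Uext (iota x) = iota (oplus_op U0 x)] &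
  exists Lp Lm : set Hext,
  [/\ [/\ linear_subspace Lp, closed Lp,
          op_invariant Uext Lp & op_invariant (inv_op Uext) Lp],
      [/\ linear_subspace Lm, closed Lm,
          op_invariant Uext Lm & op_invariant (inv_op Uext) Lm],
      strictly_positive form_ext Lp /\ strictly_negative form_ext Lm,
      Lp `&` Lm = [set 0] /\ closure (sum_set Lp Lm) = [set: Hext] &
      (forall x y, Lp x -> Lm y -> form_ext x y = 0) /\
      (maximal_nonnegative form_ext Lp /\ maximal_nonpositive form_ext Lm)]]].
Proof.
move=> D; have hs := real_or_complex_scalars hK.
have [bU0 _ _] := hU0.
pose S := orbit_span U0 x0.
have Slin : linear_subspace S := lspan_linear _.
have Dlin : linear_subspace D.
  split=> [|a p q [p1 p2] [q1 q2]]; first by split; exact: subspace0 Slin.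
  by split; exact: Slin.2.
have orbS N : S (zpow U0 N x0) by apply: sub_lspan; exists N.
pose s N := form0 x0 (zpow U0 N x0).
have s_conj N : conj (s (- N)) = s N.
  rewrite /s -(formC hform0) -(unitary_zpow hU0 N) -(zpowD bU0) subrr.
  by [].

(* The Hilbert sum and its unitary operator V *)
pose E := l2prod (sqrts hs) H H.
pose A := adjoint dot U.
pose V : E -> E := fun p => (U p.1, inv_op A p.2).
have bU := shift_bijective hs hdot hb hu_neq0 hu_conj hU.
have bA := adjoint_shift_bijective hs hdot hb hu_neq0 hu_conj hU.
have iUb := inv_shift_bounded hs hdot hb hu_neq0 hu_conj hU.
have iAE : inv_op A = adjoint dot (inv_op U) :=
  inv_adjointE hs hdot hb hu_neq0 hu_conj hU.
have iUlin := inv_op_linear (linearP U) bU.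
have iAlin : linear (inv_op A) by rewrite iAE; exact: (adjoint_linear hs hdot iUlin iUb).
have iAb : bounded_op (inv_op A) by rewrite iAE; exact: (adjoint_bounded hs hdot iUlin iUb).
have zpowV N (p : E) : zpow V N p = (zpow U N p.1, zpow A (- N) p.2).
  exact: (zpow_dual hs hdot hb hu_neq0 hu_conj hU).
have hform : hermitian_form conj (swap_form dot : E -> E -> K) :=
  swap_form_hermitian hs hdot.
have V_unitary : form_unitary (swap_form dot : E -> E -> K) V :=
  dual_unitary hs hdot hb hu_neq0 hu_conj hU.
have [bV _ _] := V_unitary.
have Vlin : linear V.
  by move=> a p q; rewrite /V /= linearP iAlin.
have [CV CV0 VC] : exists2 C, 0 < C & forall p : E, `|V p| <= C * `|p|.
  have [C1 C10 UC] := bounded_op_gt0 hU.1.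
  have [C2 C20 AC] := bounded_op_gt0 iAb.
  exists (C1 + C2) => [|p]; first by rewrite addr_gt0.
  rewrite (le_trans (l2prod_norm_le _))// mulrDl lerD//=.
    by rewrite (le_trans (UC _))// ler_wpM2l ?(ltW C10)// norm_fst_le.
  by rewrite (le_trans (AC _))// ler_wpM2l ?(ltW C20)// norm_snd_le.

(* The isometric embedding of the two orbit spans *)
pose gen (ep : K) : E := (b 0, ep *: f0).
(* After the power of [A] is moved onto b 0, each of the two products is a coordinate of f0 times a
   ratio of weights. The weights cancel, leaving ep' / 2 and ep / 2 times s N. *)
have form_gen ep ep' N : conj ep = ep ->
    swap_form dot (gen ep) (zpow V N (gen ep')) = (ep + ep') / 2 * s N.
  move=> epE; rewrite zpowV /swap_form/=.
  rewrite -(adjoint_zpow hs hdot (linearP U) hU.1 bU bA).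
  rewrite !(zpow_shift hs hdot hb hu_neq0 hu_conj hU).
  rewrite !(formZl hs hdot.1) !(formZr hdot.1) epE (formC hdot.1 (b N)) !hf0.
  rewrite !(conjM hs) !(conjV hs) !(conjK hs) s_conj.
  rewrite -[form0 x0 (zpow U0 N x0)]/(s N) (conj_nneg hs (ler0n _ 2)).
  by field; rewrite ?conj_eq0 ?hu_neq0.
have extend ep := lin_indep_extend (fun N => zpow V N (gen ep)) hx0_indep.
have [phip [plin pE]] := extend 1; have [phim [mlin mE]] := extend (- 1).
(* The factor is 1 or -1 for equal signs and 0 for opposite ones, so the two halves are mutually
   orthogonal. *)
have form_phi ep ep' (phi psi : H0 -> E) : conj ep = ep ->
    linear_on S phi -> linear_on S psi ->
    (forall N, phi (zpow U0 N x0) = zpow V N (gen ep)) ->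
    (forall N, psi (zpow U0 N x0) = zpow V N (gen ep')) ->
    forall x y, S x -> S y ->
    swap_form dot (phi x) (psi y) = (ep + ep') / 2 * form0 x y.
  move=> epE phil psil phiE psiE; apply: (form_lspan_eq hs hform0 hform phil psil).
  move=> _ _ [M _ <-] [N _ <-]; rewrite phiE psiE.
  by rewrite (unitary_zpowC V_unitary) form_gen// (unitary_zpowC hU0).
have c1 := conj1 hs; have cN1 : conj (- 1) = - 1 by rewrite (conjN hs) c1.
have phi_U0 ep (phi : H0 -> E) : linear_on S phi ->
    (forall N, phi (zpow U0 N x0) = zpow V N (gen ep)) ->
    forall x, S x -> phi (U0 x) = V (phi x).
  move=> phil phiE; apply: linear_on_lspan_eq.
  - move=> a x y Sx Sy; rewrite linearP phil//.
      by have [] := orbit_span_invariant bU0 Sx.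
    by have [] := orbit_span_invariant bU0 Sy.
  - by move=> a x y Sx Sy; rewrite phil// Vlin.
  - by move=> _ [N _ <-]; rewrite -zpowS// !phiE zpowS.
pose iota (p : H0 * H0) : E := phip p.1 + phim p.2.
have iota_lin : linear_on D iota.
  move=> a p q [p1 p2] [q1 q2]; rewrite /iota /= plin// mlin//.
  by rewrite scalerDr addrACA.
have iotaB p q : D p -> D q -> iota (p - q) = iota p - iota q.
  by move=> Dp Dq; rewrite -scaleN1r addrC iota_lin// scaleN1r addrC.
have formE x y : D x -> D y ->
    swap_form dot (iota x) (iota y) = minus_form form0 x y.
  move=> [x1 x2] [y1 y2]; rewrite /iota (formDl hs hform) !(formDr hform).
  rewrite (form_phi 1 1 phip phip)// (form_phi 1 (-1) phip phim)//.
  rewrite (form_phi (-1) 1 phim phip)// (form_phi (-1) (-1) phim phim)//.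
  by rewrite /minus_form; field.
have iotaU x : D x -> iota (oplus_op U0 x) = V (iota x).
  move=> [Dx1 Dx2]; rewrite /iota /= (phi_U0 1 phip)// (phi_U0 (-1) phim)//.
  by have := Vlin 1 (phip x.1) (phim x.2); rewrite !scale1r.
have nondeg x : S x -> (forall z, S z -> form0 x z = 0) -> x = 0.
  exact: (orbit_span_nondegenerate hs hform0 hU0 hU0_neutral).
(* A vector in the kernel of [iota] is in the radical of the minus form; testing against (z, 0) and
   (0, z) treats the components separately. *)
have iota_inj x : D x -> iota x = 0 -> x = 0.
  move=> Dx x0E; have mf y : D y -> minus_form form0 x y = 0.
    by move=> Dy; rewrite -formE// x0E (form0l hs hform).
  case: x Dx {x0E} mf => x1 x2 [Dx1 Dx2] mf.
  congr (_, _); apply: nondeg => // z Sz.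
    have := mf (z, 0); rewrite /minus_form/= (form0r hform0) subr0; apply.
    by split=> //; exact: subspace0 Slin.
  have := mf (0, z); rewrite /minus_form/= (form0r hform0) sub0r => H1.
  by apply/eqP; rewrite -oppr_eq0 H1//; split=> //; exact: subspace0 Slin.
(* This is the premise of Property A. If f0 = 0, all s N vanish, so x0 is in the radical and is 0,
   against the independence of the orbit. *)
have f0_neq0 : f0 != 0.
  apply/eqP => f00; have x00 : x0 = 0.
    apply: nondeg; first exact: (orbS 0).
    apply: (@linear_on_lspan_eq K H0 K^o _ (form0 x0) (fun=> 0)).
    - by move=> a x y _ _; rewrite (formPr hform0).
    - by move=> a x y _ _; rewrite scaler0 addr0.
    - move=> _ [N _ <-]; apply/eqP; rewrite -(conj_eq0 hs).
      have /esym/eqP := hf0 N; rewrite f00 (form0r hdot.1) !mulf_eq0 invr_eq0.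
      by rewrite pnatr_eq0 invr_eq0 !(conj_eq0 hs) !(negPf (hu_neq0 _)).
  have := @hx0_indep [:: 0] (fun=> 1) isT; rewrite big_seq1 /= x00 scaler0.
  by move=> /(_ erefl 0 (mem_head _ _)) /eqP; rewrite oner_eq0.
pose dotE := fun p q : E => dot p.1 q.1 + dot p.2 q.2.
have hdotE : inner_product conj dotE := l2prod_inner (sqrts hs) hs hdot hdot.
have iota_dense : closure (iota @` D) = [set: E].
  apply: (orth_dense hs hdotE).
    split; first by exists 0; [exact: subspace0 Dlin|exact: linear_on0 Dlin iota_lin].
    move=> a _ _ [p Dp <-] [q Dq <-]; exists (a *: p + q); first exact: Dlin.2.
    exact: iota_lin.
  (* The Hilbert product with q is the swap form with (q.2, q.1), to which Property A applies. *)
  move=> q orth; suff [q2 q1] : (q.2, q.1) = (0, 0) :> H * H.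
    by case: q q1 q2 {orth} => ? ? /= -> ->.
  apply: hA => // _ [x xp [y ym <-]].
  have lin0 : linear_subspace [set p : E | swap_form dot p (q.2, q.1) = 0].
    split=> [|a p p' Hp Hp'] /=; first by rewrite (form0l hs hform).
    by rewrite (formDl hs hform) (formZl hs hform) Hp Hp' mulr0 addr0.
  have S0 := subspace0 Slin.
  rewrite -[(x + y)%R]/(x + y : E) (formDl hs hform).
  have -> : swap_form dot x (q.2, q.1) = 0.
    apply: (lspan_sub lin0) xp => _ [N _ <-].
    have := orth _ (ex_intro2 _ _ (zpow U0 N x0, 0) (Logic.conj (orbS N) S0) erefl).
    by rewrite /iota/= pE (linear_on0 Slin mlin) addr0 zpowV /gen scale1r.
  have -> : swap_form dot y (q.2, q.1) = 0.
    apply: (lspan_sub lin0) ym => _ [N _ <-].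
    have := orth _ (ex_intro2 _ _ (0, zpow U0 N x0) (Logic.conj S0 (orbS N)) erefl).
    by rewrite /iota/= mE (linear_on0 Slin plin) add0r zpowV /gen scaleN1r.
  by rewrite addr0.
have form_cont := bounded_form_continuous hs hform (ler0n K 2)
  (swap_form_bound (hs := hs) hdot).

(* The pulled-back norm and the continuous extensions *)
exists (fun p => `|iota p|); split.
- exists (fun p q => dotE (iota p) (iota q)); split=> //.
  + split=> [p Dp a q r Dq Dr|p q Dp Dq]; first by rewrite iota_lin// (formPr hdotE.1).
    exact: (formC hdotE.1).
  + by move=> p _; rewrite (dotxx hdotE).
  + by move=> p Dp /eqP; rewrite normr_eq0 => /eqP; exact: iota_inj.
- move=> x y Dx Dy e e0; have [d d0 dP] := form_cont (iota x) (iota y) e e0.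
  exists d => // x' y' Dx' Dy'; rewrite !iotaB// => xd yd.
  by rewrite -!formE//; exact: dP.
- move=> x Dx e e0; exists (e / CV); first by rewrite divr_gt0.
  move=> y Dy; rewrite ltr_pdivlMr// mulrC; apply: le_lt_trans.
  have -> : oplus_op U0 y - oplus_op U0 x = oplus_op U0 (y - x).
    by rewrite /oplus_op /= !linearB.
  by rewrite iotaU//; exact: (subspaceB Dlin).
pose Vext : {linear E -> E} := HB.pack V (GRing.isLinear.Build K E E *:%R V Vlin).
exists E, dotE, iota, (swap_form dot : E -> E -> K), Vext; split.
- by split=> //; split.
- split=> // p; apply/cvgrPdist_lt => e e0.
  have [d d0 dP] := form_cont p.1 p.2 e e0.
  exists (ball p.1 d, ball p.2 d); first by split; exact: nbhsx_ballx.
  move=> q [/= q1 q2]; rewrite distrC; apply: dP; rewrite distrC.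
    by move: q1; rewrite -ball_normE.
  by move: q2; rewrite -ball_normE.
- split=> //; first by apply: bounded_linear_continuous; exists CV.
  by move=> x Dx; rewrite iotaU.

(* The invariant graphs *)
pose w n := `|u n| ^+ 2.
have w_gt0 n : 0 < w n by rewrite exprn_gt0// normr_gt0.
have s1 : (1 : K) ^+ 2 = 1 by rewrite expr1n.
have sN1 : (- 1 : K) ^+ 2 = 1 by rewrite sqrrN expr1n.
pose L (sg : K) : set E := weight_graph dot b w sg.
have LV sg p : L sg (V p) <-> L sg p.
  (* The defect of V p at n + 1 is a nonzero multiple of the defect of p at n; the equivalence gives
     invariance under V and its inverse at once. *)
  have coefE n : sg * dot (b (n + 1)) (V p).1 - w (n + 1) * dot (b (n + 1)) (V p).2
     = u (n + 1) / u n * (sg * dot (b n) p.1 - w n * dot (b n) p.2).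
    rewrite /= (shift_coef hs hdot hb hU).
    rewrite (inv_adjoint_coef hs hdot hb hu_neq0 hu_conj hU) /w.
    rewrite -!(conj_norm hs) (conjM hs) (conjV hs).
    by field; rewrite ?conj_eq0 ?hu_neq0.
  split=> Lp n; apply/eqP; rewrite -subr_eq0.
    have /eqP := Lp (n + 1); rewrite -subr_eq0 coefE mulf_eq0 mulf_eq0 invr_eq0.
    by rewrite !(negPf (hu_neq0 _)).
  by rewrite -[n](subrK 1) coefE Lp subrr mulr0.
have Linv sg : op_invariant Vext (L sg) /\ op_invariant (inv_op Vext) (L sg).
  split=> _ [p Lp <-]; first exact/LV.
  by apply/LV; rewrite (inv_opVK bV).
have Lpos p : L 1 p -> p != 0 -> 0 < swap_form dot p p.
  by move=> Lp p0; have := weight_graph_sign (hs := hs) hdot hb w_gt0 s1 Lp p0; rewrite mul1r.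
have Lneg p : L (- 1) p -> p != 0 -> swap_form dot p p < 0.
  move=> Lp p0; have := weight_graph_sign (hs := hs) hdot hb w_gt0 sN1 Lp p0.
  by rewrite mulN1r oppr_gt0.
have Llin sg : linear_subspace (L sg) by exact: (weight_graph_linear hs hdot).
exists (L 1), (L (- 1)); split.
- by case: (Linv 1) => ? ?; split=> //; exact: (weight_graph_closed (hs := hs) hdot w_gt0).
- by case: (Linv (- 1)) => ? ?; split=> //; exact: (weight_graph_closed (hs := hs) hdot w_gt0).
- by [].
- split; last exact: (weight_graph_dense hs hdot hb w_gt0 s1).
  apply/seteqP; split=> [p [Lp Lm]|_ ->]; last by split; exact: subspace0.
  apply/eqP; apply: contraT => p0.
  by have := lt_trans (Lpos _ Lp p0) (Lneg _ Lm p0); rewrite ltxx.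
- split; first by move=> p q; exact: (weight_graph_orthogonal (hs := hs) hdot hb w_gt0 s1).
  split; split.
  + move=> p Lp; have [->|p0] := eqVneq p 0; first by rewrite (form0r hform).
    exact/ltW/Lpos.
  + move=> M Mlin M0 [LM]; apply.
    apply: (weight_graph_maximal (hs := hs) hdot hb w_gt0 s1) => // p Mp.
    by rewrite mul1r; exact: M0.
  + move=> p Lp; have [->|p0] := eqVneq p 0; first by rewrite (form0r hform).
    exact/ltW/Lneg.
  + move=> M Mlin M0 [LM]; apply.
    apply: (weight_graph_maximal (hs := hs) hdot hb w_gt0 sN1) => // p Mp.
    by rewrite mulN1r oppr_ge0; exact: M0.
Qed.
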